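(* Let $k,s,n$ be positive integers, let $\varepsilon\in[0,1]$ and let $\delta\in(0,1)$ be the tolerance level. Let $\bar{\boldsymbol X}_n=\frac1n\sum_{i=1}^n\boldsymbol X_i$. If $\boldsymbol\theta^*\in\Delta_s^{k-1}$, then under any contamination model, i.e., for every $\square\in\{\mathrm{HC},\mathrm{HDC},\mathrm{OC},\mathrm{PC},\mathrm{AC}\}$ and every joint distribution of $(\boldsymbol X_1,\dots,\boldsymbol X_n)$ in $\mathcal M_n^{\square}(\varepsilon,\boldsymbol\theta^* )$, each of the three regions of $\boldsymbol\theta\in\Delta^{k-1}$ defined respectively by the inequalities $$d_{\mathbb L^2}(\bar{\boldsymbol X}_n,\boldsymbol\theta)\le (1/n)^{1/2}+\sqrt2\,\varepsilon+\big(\log(1/\delta)/n\big)^{1/2},$$ $$d_{\mathrm{TV}}(\bar{\boldsymbol X}_n,\boldsymbol\theta)\le (s/n)^{1/2}+2\varepsilon+\big(2\log(1/\delta)/n\big)^{1/2},$$ $$d_{\mathrm H}(\bar{\boldsymbol X}_n,\boldsymbol\theta)\le 3.2\big((s/n)\log(2s/\delta)\big)^{1/2}+(2\varepsilon)^{1/2}+\big((1/n)\log(2/\delta)\big)^{1/2},$$ contains $\boldsymbol\theta^*$ with probability at least $1-\delta$.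
   Context: The probability simplex is $\Delta^{k-1}=\{\boldsymbol v\in\mathbb R_+^k: v_1+\dots+v_k=1\}$, and $\Delta_s^{k-1}$ is the set of all $\boldsymbol v\in\Delta^{k-1}$ having at most $s$ non-zero entries. Distances on $\Delta^{k-1}$: $d_{\mathrm{TV}}(\boldsymbol\theta,\boldsymbol\theta')=\frac12\sum_{j=1}^k|\theta_j-\theta'_j|$; $d_{\mathrm H}(\boldsymbol\theta,\boldsymbol\theta')=\big(\sum_{j=1}^k(\sqrt{\theta_j}-\sqrt{\theta'_j})^2\big)^{1/2}$; $d_{\mathbb L^2}(\boldsymbol\theta,\boldsymbol\theta')=\big(\sum_{j=1}^k(\theta_j-\theta'_j)^2\big)^{1/2}$. Contamination models. The reference distribution $\boldsymbol P$ is any probability distribution on $\Delta^{k-1}$ with mean $\boldsymbol\theta^*$; all observations $\boldsymbol X_1,\dots,\boldsymbol X_n$ take values in $\Delta^{k-1}$. Each $\mathcal M_n^\square(\varepsilon,\boldsymbol\theta^* )$ is the set of all joint distributions of $(\boldsymbol X_1,\dots,\boldsymbol X_n)$ arising (for some such $\boldsymbol P$) as follows. - HC (Huber): $\boldsymbol X_1,\dots,\boldsymbol X_n$ are i.i.d. from $(1-\varepsilon)\boldsymbol P+\varepsilon\boldsymbol Q$ for some probability distribution $\boldsymbol Q$ on $\Delta^{k-1}$. - HDC (Huber deterministic): there are a deterministic set $O\subset\{1,\dots,n\}$ of cardinality at most $n\varepsilon$ and a distribution $\boldsymbol Q$ on $\Delta^{k-1}$ such that $\{\boldsymbol X_i:i\notin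 O\}$ are i.i.d. from $\boldsymbol P$, $\{\boldsymbol X_i:i\in O\}$ are i.i.d. from $\boldsymbol Q$, and these two families are independent. - OC (oblivious): there are a deterministic set $O$ of cardinality at most $n\varepsilon$ and an arbitrary joint distribution $\boldsymbol Q_O$ such that $\{\boldsymbol X_i:i\notin O\}$ are i.i.d. from $\boldsymbol P$, $(\boldsymbol X_i)_{i\in O}\sim\boldsymbol Q_O$, and the two families are independent. - PC (parameter contamination): there is a deterministic set $O$ of cardinality at most $n\varepsilon$ such that $\boldsymbol X_1,\dots,\boldsymbol X_n$ are independent, $\boldsymbol X_i\sim\boldsymbol P$ for $i\notin O$, and for $i\in O$ the variable $\boldsymbol X_i$ is drawn from a distribution on $\Delta^{k-1}$ with some mean $\boldsymbol\theta_i\ne\boldsymbol\theta^*$. - AC (adversarial): $\boldsymbol Y_1,\dots,\boldsymbol Y_n$ are drawn i.i.d. from $\boldsymbol P$; then an adversary having access to them chooses a random set $\hat O\subset\{1,\dots,n\}$ (possibly depending on the $\boldsymbol Y_i$) of deterministic cardinality at most $n\varepsilon$ and arbitrarily modifies the points $\boldsymbol Y_i$, $i\in\hat O$, within $\Delta^{k-1}$; thus $\boldsymbol X_i=\boldsymbol Y_i$ for $i\notin\hat O$. *)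

(* Defs.v *)
From HB Require Import structures.
From mathcomp Require Import all_boot all_order all_algebra.
From mathcomp Require Import all_classical all_reals all_analysis.

Set Implicit Arguments.
Unset Strict Implicit.
Unset Printing Implicit Defensive.

Import Order.TTheory GRing.Theory Num.Theory.
Import numFieldNormedType.Exports.

Local Open Scope classical_set_scope.
Local Open Scope ring_scope.

Definition simplex (R : realType) (k : nat) : set (k.-tuple R) :=
  [set v : k.-tuple R | (forall j, 0 <= tnth v j) /\ \sum_(j < k) tnth v j = 1].

Definition sparse_simplex (R : realType) (k s : nat) : set (k.-tuple R) :=
  [set v : k.-tuple R | simplex v /\ (#|[set j : 'I_k | (tnth v j != 0)%R]%SET| <= s)%N].

Definition dTV (R : realType) (k : nat) (u v : k.-tuple R) : R :=
  2^-1 * \sum_(j < k) `|tnth u j - tnth v j|.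

Definition dH (R : realType) (k : nat) (u v : k.-tuple R) : R :=
  Num.sqrt (\sum_(j < k) (Num.sqrt (tnth u j) - Num.sqrt (tnth v j)) ^+ 2).

Definition dL2 (R : realType) (k : nat) (u v : k.-tuple R) : R :=
  Num.sqrt (\sum_(j < k) (tnth u j - tnth v j) ^+ 2).

Definition sample_mean (R : realType) (k n : nat) (x : n.-tuple (k.-tuple R)) :
    k.-tuple R :=
  [tuple n%:R^-1 * \sum_(i < n) tnth (tnth x i) j | j < k].

Definition region (R : realType) (k : nat) (dist : k.-tuple R -> k.-tuple R -> R)
    (c : k.-tuple R) (r : R) : set (k.-tuple R) :=
  [set theta | simplex theta /\ dist c theta <= r].

(* Distributions on the simplex are the probability measures on the ambient
   space (with its product Borel sigma-algebra) giving mass 1 to the simplex. *)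
Definition on_simplex (R : realType) (k : nat)
    (P : probability (k.-tuple R) R) : Prop :=
  P (@simplex R k) = 1%E.

Definition has_mean (R : realType) (k : nat) (P : probability (k.-tuple R) R)
    (theta : k.-tuple R) : Prop :=
  forall j : 'I_k, ('E_P[fun v => tnth v j] = (tnth theta j)%:E)%E.

Section independence.
Context {d d' : measure_display} {Omega : measurableType d}
  {V : measurableType d'} {R : realType}.
Variable Pr : probability Omega R.

Definition has_law (Y : {RV Pr >-> V}) (mu : set V -> \bar R) : Prop :=
  forall A, measurable A -> distribution Pr Y A = mu A.

Definition mutually_independent (n : nat) (I : {set 'I_n})
    (X : 'I_n -> {RV Pr >-> V}) : Prop :=
  forall J : {set 'I_n}, J \subset I ->
  forall A : 'I_n -> set V, (forall i, measurable (A i)) ->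
    (Pr (\bigcap_(i in [set` J]) (X i @^-1` A i)) =
     \prod_(i in J) Pr (X i @^-1` A i))%E.

Definition sigma_family (n : nat) (I : {set 'I_n})
    (X : 'I_n -> {RV Pr >-> V}) : set (set Omega) :=
  <<s \bigcup_(i in [set` I]) preimage_set_system setT (X i) measurable >>.

Definition independent_families (n : nat) (I J : {set 'I_n})
    (X : 'I_n -> {RV Pr >-> V}) : Prop :=
  forall A B, sigma_family I X A -> sigma_family J X B ->
    (Pr (A `&` B) = Pr A * Pr B)%E.

Definition iid (n : nat) (I : {set 'I_n}) (X : 'I_n -> {RV Pr >-> V})
    (mu : set V -> \bar R) : Prop :=
  mutually_independent I X /\ (forall i, i \in I -> has_law (X i) mu).

End independence.

Section contamination.
Context {d : measure_display} {Omega : measurableType d} {R : realType}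
  {k n : nat}.
Variables (Pr : probability Omega R) (X : 'I_n -> {RV Pr >-> k.-tuple R}).
Variables (eps : R) (P : probability (k.-tuple R) R) (theta : k.-tuple R).

Definition huber : Prop :=
  exists Q : probability (k.-tuple R) R, on_simplex Q /\
    iid [set: 'I_n]%SET X (fun A => (1 - eps)%:E * P A + eps%:E * Q A)%E.

Definition huber_deterministic : Prop :=
  exists (O : {set 'I_n}) (Q : probability (k.-tuple R) R),
    [/\ #|O|%:R <= n%:R * eps, on_simplex Q, iid (~: O)%SET X P, iid O X Q &
        independent_families (~: O)%SET O X].

(* The joint law of the outliers is unrestricted, so no condition mentions it. *)
Definition oblivious : Prop :=
  exists O : {set 'I_n},
    [/\ #|O|%:R <= n%:R * eps, iid (~: O)%SET X P &
        independent_families (~: O)%SET O X].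

Definition parameter_contamination : Prop :=
  exists (O : {set 'I_n}) (Q : 'I_n -> probability (k.-tuple R) R)
         (theta_ : 'I_n -> k.-tuple R),
    [/\ #|O|%:R <= n%:R * eps,
        mutually_independent [set: 'I_n]%SET X,
        (forall i, i \notin O -> has_law (X i) P) &
        (forall i, i \in O ->
           [/\ on_simplex (Q i), has_mean (Q i) (theta_ i),
               theta_ i <> theta & has_law (X i) (Q i)])].

(* The adversary may randomize: Y, the random set Ohat and X live on one
   probability space, with no restriction on their joint law beyond these. *)
Definition adversarial : Prop :=
  exists (Y : 'I_n -> {RV Pr >-> k.-tuple R}) (Ohat : Omega -> {set 'I_n})
         (o : nat),
    [/\ iid [set: 'I_n]%SET Y P,
        (forall i, measurable [set w | i \in Ohat w]),
        o%:R <= n%:R * eps,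
        (forall w, #|Ohat w| = o) &
        (forall w i, i \notin Ohat w -> X i w = Y i w)].

End contamination.

Inductive contamination := HC | HDC | OC | PC | AC.

Definition contaminated (m : contamination) (d : measure_display)
    (Omega : measurableType d) (R : realType) (k n : nat)
    (Pr : probability Omega R) (X : 'I_n -> {RV Pr >-> k.-tuple R}) (eps : R)
    (P : probability (k.-tuple R) R) (theta : k.-tuple R) : Prop :=
  match m with
  | HC => huber X eps P
  | HDC => huber_deterministic X eps P
  | OC => oblivious X eps P
  | PC => parameter_contamination X eps P theta
  | AC => adversarial X eps P
  end.

(* [model m n eps theta] is the set of the joint distributions of
   (X_1, ..., X_n), as measures on the space of samples. *)
Definition model (m : contamination) (R : realType) (k n : nat) (eps : R)
    (theta : k.-tuple R) : set (probability (n.-tuple (k.-tuple R)) R) :=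
  [set mu | exists (d : measure_display) (Omega : measurableType d)
      (Pr : probability Omega R) (X : 'I_n -> {RV Pr >-> k.-tuple R})
      (P : probability (k.-tuple R) R),
    [/\ on_simplex P, has_mean P theta,
        (forall i w, simplex (X i w)),
        contaminated m X eps P theta &
        (forall A, measurable A -> mu A = Pr [set w | A [tuple X i w | i < n]])]].

(* Main.v *)
Require Import Defs.
From HB Require Import structures.
From mathcomp Require Import all_boot all_order all_algebra.
From mathcomp Require Import ring lra.
From mathcomp Require Import all_classical all_reals all_analysis.

Set Implicit Arguments.
Unset Strict Implicit.
Unset Printing Implicit Defensive.

Import Order.TTheory GRing.Theory Num.Theory.
Import numFieldNormedType.Exports.
Import measurable_realfun.

Local Open Scope classical_set_scope.
Local Open Scope ring_scope.

(** Each contaminated sample contains independent draws with a common law [nu] on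
the simplex, of mean [q], and its empirical mean [x] is close to the mean [u] of
these draws, completed by [q] at the indices without such a draw. With deterministic
or adversarial outliers [q = theta] and the total variation distance from [x] to [u]
is at most [eps], each corrupted index moving the mean by at most [1/n]. In Huber's
mixture [x = u] and it is [q] that lies within [eps] of [theta]
([contaminated_core]). What remains is to show that [u] concentrates around [q],
which may have full support, and to compare the distances.

_Euclidean distance and total variation._ McDiarmid's inequality applies to the
norm of the sum of the centred draws (increments [sqrt 2]) and to the mass missing
from the support [S] of [theta] (increments [1]); the means are controlled by the
second moment of the sum, which is at most [n]. The missing mass replaces the total
variation because [dTV x theta], for [theta] carried by [S], is the mass that [x]
lacks in [S] ([dTV_sparse]). McDiarmid's inequality is proved for a recursion
[u_(i+1) = step u_i Z_i]: integrating out one draw at a time replaces the function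
by its average over that draw, which keeps the bounded differences, and Hoeffding's
lemma bounds the loss in the exponential moment ([walk_expR], [mcdiarmid]). A
quadratic Lyapunov function bounds the iterated averages
([iter_average_lyapunov]).

_Hellinger distance._ The mass that [n u] gives to a set of coordinates has at most
the exponential moments of a Poisson variable, and for such a variable the square
root deviates by more than [x] from the square root of the mean with probability at
most [exp (- n x^2)] on either side ([sqrt_mass_upper_tail],
[sqrt_mass_lower_tail]). This is applied to every coordinate of [S] and, once, to
the whole complement of [S]; that last event produces the third term of the radius.
The bias then adds [sqrt (2 * dTV q theta)] by Minkowski's inequality
([dH_sparse_le]). *)

(** * Elementary inequalities *)

(** The tangent to the exponential at [t * h], read at [0] and at [h]. *)
Lemma expR_chord (R : realType) (t h : R) :
  0 <= t <= 1 -> expR (t * h) <= 1 - t + t * expR h.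
Proof.
move=> /andP[t0 t1].
have e0 := expR_gt0 (t * h).
have H1 : expR (t * h) * (1 + (1 - t) * h) <= expR h.
  rewrite (_ : expR h = expR (t * h) * expR ((1 - t) * h)); last first.
    by rewrite -expRD; congr expR; ring.
  by rewrite ler_pM2l// expR_ge1Dx.
have H2 : expR (t * h) * (1 - t * h) <= 1.
  rewrite [leRHS](_ : _ = expR (t * h) * expR (- (t * h))); last first.
    by rewrite -expRD subrr expR0.
  by rewrite ler_pM2l// expR_ge1Dx.
have t1' : 0 <= 1 - t by rewrite subr_ge0.
have := lerD (ler_wpM2l t1' H2) (ler_wpM2l t0 H1).
by rewrite mulr1; apply: le_trans; rewrite le_eqVlt; apply/predU1P; left; ring.
Qed.

(** The logistic curve [p e^x / (1 - p + p e^x)] starts at [p] and its slope is at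
most [1/4], being of the form [q (1 - q)]. *)
Lemma hoeffding_slope (R : realType) (p h : R) : 0 <= p <= 1 -> 0 <= h ->
  p * expR h <= (p + h / 4) * (1 - p + p * expR h).
Proof.
move=> /andP[p0 p1] h0.
have D0 x : 0 < 1 - p + p * expR x.
  have [->|pn0] := eqVneq p 0; first by rewrite mul0r subr0 addr0 ltr01.
  by rewrite ltr_wpDl ?subr_ge0// mulr_gt0 ?expR_gt0// lt_neqAle eq_sym pn0.
rewrite -ler_pdivrMr//.
pose F (x : R) : R := p + x / 4 - p * expR x / (1 - p + p * expR x).
have dF (x : R) : is_derive x 1 F
    (4^-1 - p * expR x * (1 - p) / (1 - p + p * expR x) ^+ 2).
  have := D0 x; rewrite lt_neqAle eq_sym => /andP[Dn0 _].
  rewrite /F.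
  apply: (@is_derive_eq _ _ _ _ _ _ _ _ _).
  by rewrite /GRing.scale/=; field; exact: Dn0.
have : F 0 <= F h.
  apply: (@ger0_derive1_ndecry _ F 0) => //.
  - move=> x _; rewrite derive1E; have [_ ->] := dF x.
    rewrite subr_ge0 ler_pdivrMr ?exprn_gt0//.
    rewrite -subr_ge0 (_ : _ - _ = ((1 - p) - p * expR x) ^+ 2 / 4).
      by rewrite divr_ge0// sqr_ge0.
    by field.
  - apply: continuous_subspaceT => x; apply: differentiable_continuous.
    by apply/derivable1_diffP; have [] := dF x.
rewrite /F mul0r expR0 addr0 mulr1 subrK divr1 subrr; lra.
Qed.

(** The quotient of the two sides decreases on [h >= 0], by the preceding bound on
its logarithmic derivative. *)
Lemma hoeffding_bernoulli (R : realType) (p h : R) : 0 <= p <= 1 -> 0 <= h ->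
  1 - p + p * expR h <= expR (p * h + h ^+ 2 / 8).
Proof.
move=> p01 h0.
pose F (x : R) : R := - ((1 - p + p * expR x) * expR (- (p * x + x ^+ 2 / 8))).
have dF (x : R) : is_derive x 1 F (((p + x / 4) * (1 - p + p * expR x)
    - p * expR x) * expR (- (p * x + x ^+ 2 / 8))).
  rewrite /F.
  apply: (@is_derive_eq _ _ _ _ _ _ _ _ _).
  by rewrite /GRing.scale/=; field.
have : F 0 <= F h.
  apply: (@ger0_derive1_ndecry _ F 0) => //.
  - move=> x; rewrite in_itv/= andbT => x0.
    rewrite derive1E; have [_ ->] := dF x.
    by rewrite mulr_ge0 ?expR_ge0// subr_ge0 hoeffding_slope// ltW.
  - apply: continuous_subspaceT => x; apply: differentiable_continuous.
    by apply/derivable1_diffP; have [] := dF x.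
rewrite (_ : F 0 = - 1); last first.
  by rewrite /F mulr0 expr0n mul0r addr0 oppr0 expR0 !mulr1 subrK.
by rewrite /F lerN2 expRN ler_pdivrMr ?expR_gt0// mul1r.
Qed.

Lemma l2_cauchy_schwarz (R : realType) (I : Type) (r : seq I) (P : pred I)
    (a b : I -> R) :
  \sum_(i <- r | P i) a i * b i <=
  Num.sqrt (\sum_(i <- r | P i) a i ^+ 2) *
  Num.sqrt (\sum_(i <- r | P i) b i ^+ 2).
Proof.
set A : R := Num.sqrt (\sum_(i <- r | P i) a i ^+ 2).
set B : R := Num.sqrt (\sum_(i <- r | P i) b i ^+ 2).
have A2 : A ^+ 2 = \sum_(i <- r | P i) a i ^+ 2.
  by rewrite sqr_sqrtr// sumr_ge0// => i _; rewrite sqr_ge0.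
have B2 : B ^+ 2 = \sum_(i <- r | P i) b i ^+ 2.
  by rewrite sqr_sqrtr// sumr_ge0// => i _; rewrite sqr_ge0.
have A0 : 0 <= A by exact: sqrtr_ge0.
have B0 : 0 <= B by exact: sqrtr_ge0.
clearbody A B.
(* Expand the nonnegative sum of the squares of [B * a i - A * b i]. *)
have H : 2 * (A * B) * (\sum_(i <- r | P i) a i * b i) <= 2 * (A * B) * (A * B).
  rewrite -subr_ge0 (_ : _ - _ = \sum_(i <- r | P i) (B * a i - A * b i) ^+ 2).
    by rewrite sumr_ge0// => i _; rewrite sqr_ge0.
  rewrite [RHS](eq_bigr (fun i => B ^+ 2 * a i ^+ 2 + A ^+ 2 * b i ^+ 2
      - 2 * (A * B) * (a i * b i))); last by move=> i _; ring.
  by rewrite !big_split/= sumrN -!mulr_sumr -A2 -B2; ring.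
have [AB0|ABn0] := eqVneq (A * B) 0; last first.
  by rewrite ler_pM2l in H; rewrite // mulr_gt0// lt_neqAle eq_sym ABn0 mulr_ge0.
rewrite AB0.
have z (c d : I -> R) : \sum_(i <- r | P i) c i ^+ 2 = 0 ->
    \sum_(i <- r | P i) c i * d i = 0.
  elim: r {A B A2 B2 A0 B0 H AB0} => [|i r IH]; first by rewrite !big_nil.
  rewrite !big_cons; case: ifP => // _ /eqP.
  rewrite paddr_eq0 ?sqr_ge0//; last by rewrite sumr_ge0// => j _; rewrite sqr_ge0.
  by rewrite sqrf_eq0 => /andP[/eqP -> /eqP /IH ->]; rewrite mul0r addr0.
move/eqP: AB0; rewrite mulf_eq0 => /orP[] /eqP e0.
  by rewrite z// -A2 e0 expr0n.
under eq_bigr do rewrite mulrC.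
by rewrite z// -B2 e0 expr0n.
Qed.

Lemma l2_triangle (R : realType) (I : Type) (r : seq I) (P : pred I) (a b : I -> R) :
  Num.sqrt (\sum_(i <- r | P i) (a i + b i) ^+ 2) <=
  Num.sqrt (\sum_(i <- r | P i) a i ^+ 2) +
  Num.sqrt (\sum_(i <- r | P i) b i ^+ 2).
Proof.
rewrite -[leRHS]ger0_norm ?addr_ge0 ?sqrtr_ge0// -sqrtr_sqr.
rewrite ler_wsqrtr// sqrrD !sqr_sqrtr; last 2 first.
- by rewrite sumr_ge0// => i _; rewrite sqr_ge0.
- by rewrite sumr_ge0// => i _; rewrite sqr_ge0.
under eq_bigr do rewrite sqrrD.
rewrite !big_split/= lerD2r lerD2l mulr2n.
by rewrite lerD// l2_cauchy_schwarz.
Qed.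

(** * Random recursions driven by independent draws *)

(** Rectangles form a pi-system generating the product sigma-algebra. *)
Lemma product_measure_ext d1 d2 (T1 : measurableType d1) (T2 : measurableType d2)
    (R : realType) (m1 m2 : {measure set (T1 * T2) -> \bar R}) :
  (m1 setT < +oo)%E ->
  (forall A B, measurable A -> measurable B -> m1 (A `*` B) = m2 (A `*` B)) ->
  forall X, measurable X -> m1 X = m2 X.
Proof.
move=> m1T m12 X mX.
pose G := [set A `*` B | A in (measurable : set (set T1)) & B in (measurable : set (set T2))].
apply: (measure_unique G (fun=> setT)) => //.
- by rewrite /G measurable_prod_measurableType.
- move=> _ _ [A mA [B mB <-]] [A' mA' [B' mB' <-]].
  rewrite -setXI; exists (A `&` A'); first exact: measurableI.
  by exists (B `&` B') => //; exact: measurableI.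
- by move=> _; exists setT => //; exists setT => //; rewrite setXTT.
- by rewrite bigcup_const.
- by move=> _ [A mA [B mB <-]]; exact: m12.
Qed.

Section walk.
Context dO (Omega : measurableType dO) (R : realType) (Pr : probability Omega R).
Context dV (V : measurableType dV) (n : nat).
Variables (I : {set 'I_n}) (Z : 'I_n -> {RV Pr >-> V}).
Hypothesis indZ : mutually_independent I Z.
Context dU (U : measurableType dU).
Variables (step : U -> V -> U) (u0 : U).
Hypothesis mstep : measurable_fun setT (fun p : U * V => step p.1 p.2).

Definition walk (l : seq 'I_n) (w : Omega) : U :=
  foldr (fun i u => step u (Z i w)) u0 l.

Lemma measurable_walk l : measurable_fun setT (walk l).
Proof.
elim: l => [|i l IH]; first exact: measurable_cst.
rewrite (_ : walk (i :: l) =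
  (fun p : U * V => step p.1 p.2) \o (fun w => (walk l w, Z i w))) //.
apply: measurableT_comp => //.
exact: measurable_fun_pair.
Qed.

HB.instance Definition _ l :=
  isMeasurableFun.Build _ _ _ _ (walk l) (measurable_walk l).

Let measurable_cap (J : {set 'I_n}) (A : 'I_n -> set V) :
  (forall i, measurable (A i)) ->
  measurable (\bigcap_(i in [set` J]) (Z i @^-1` A i)).
Proof.
move=> mA; apply: fin_bigcap_measurable => // i _.
by rewrite -[_ @^-1` _]setTI; exact: measurable_funP.
Qed.

(** The statement carries the coordinates [J] not yet used so that the
induction on [l] can consume one of them: the pair (current state, next
draw), seen on the event given by [J], has a product law since it has one on
rectangles. *)
Lemma walk_independent (l : seq 'I_n) (J : {set 'I_n}) (B : set U)
    (A : 'I_n -> set V) :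
  uniq l -> {subset l <= I} -> J \subset I -> (forall i, i \in l -> i \notin J) ->
  measurable B -> (forall i, measurable (A i)) ->
  (Pr (walk l @^-1` B `&` \bigcap_(i in [set` J]) (Z i @^-1` A i)) =
   Pr (walk l @^-1` B) * \prod_(i in J) Pr (Z i @^-1` A i))%E.
Proof.
elim: l J B A => [|i l IH] J B A /=.
  move=> _ _ JI _ mB mA.
  have [u0B|u0B] := pselect (B u0).
    rewrite (_ : walk [::] @^-1` B = setT); last by apply/seteqP; split.
    by rewrite setTI probability_setT mul1e; exact: indZ.
  rewrite (_ : walk [::] @^-1` B = set0); last by apply/seteqP; split.
  by rewrite set0I measure0 mul0e.
move=> /andP[il ul] lI JI lJ mB mA.
have iJ : i \notin J by apply: lJ; rewrite mem_head.
have iI : i \in I by apply: lI; rewrite mem_head.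
have lI' : {subset l <= I} by move=> j jl; apply: lI; rewrite in_cons jl orbT.
have lJ' j : j \in l -> j \notin J by move=> jl; apply: lJ; rewrite in_cons jl orbT.
set E := \bigcap_(_ in _) _.
have mE : measurable E by exact: measurable_cap.
set q := (\prod_(j in J) _)%E.
have q0 : (0 <= q)%E by apply: prode_ge0 => j _; exact: measure_ge0.
have qfin : q \is a fin_num.
  rewrite /q; apply: (big_ind (fun x : \bar R => x \is a fin_num)) => //.
    by move=> x y; exact: fin_numM.
  by move=> j _; apply: fin_num_measure; exact: measurable_funPTI.
have rect (A1 : set U) (A2 : set V) : measurable A1 -> measurable A2 ->
    Pr (walk l @^-1` A1 `&` Z i @^-1` A2) =
      (Pr (walk l @^-1` A1) * Pr (Z i @^-1` A2))%E.
  move=> mA1 mA2.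
  have := @IH [set i]%SET A1 (fun=> A2) ul lI'.
  rewrite big_set1 (_ : [set` [set i]%SET] = [set i]); last first.
    by apply/seteqP; split => j /=; rewrite inE => /eqP.
  rewrite bigcap_set1; apply => //; first by rewrite finset.sub1set.
  by move=> j jl; rewrite inE; apply: contraNneq il => <-.
have rectE (A1 : set U) (A2 : set V) : measurable A1 -> measurable A2 ->
    Pr (walk l @^-1` A1 `&` Z i @^-1` A2 `&` E) =
      (Pr (walk l @^-1` A1) * Pr (Z i @^-1` A2) * q)%E.
  move=> mA1 mA2.
  pose A' j := if j == i then A2 else A j.
  have := @IH (i |: J)%SET A1 A' ul lI'.
  rewrite (big_setU1 i)//= {1 3}/A' eqxx.
  rewrite (_ : [set` (i |: J)%SET] = i |` [set` J]); last first.
    apply/seteqP; split => j /=; rewrite !inE.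
      by move=> /orP[/eqP|]; [left|right].
    by move=> [->|->]; rewrite ?eqxx ?orbT.
  rewrite bigcap_setU1.
  have nei j : j \in J -> (j == i) = false.
    by move=> jJ; apply: contraNF iJ => /eqP <-.
  rewrite (_ : \bigcap_(j in [set` J]) (Z j @^-1` A' j) = E); last first.
    by apply: eq_bigcapr => j /= jJ; rewrite /A' nei.
  rewrite (eq_bigr (fun j => Pr (Z j @^-1` A j))); last first.
    by move=> j jJ; rewrite /A' nei.
  rewrite -/q {1}/A' eqxx setIA muleA; apply => //.
  - by rewrite finset.subUset finset.sub1set iI.
  - move=> j jl; rewrite !inE negb_or lJ'// andbT.
    by apply: contraNneq il => <-.
  - by move=> j; rewrite /A'; case: ifP.
pose f w := (walk l w, Z i w).
have mf : measurable_fun setT f by exact: measurable_fun_pair.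
pose m1 := pushforward (mrestr Pr mE) f.
have qE : q = (NngNum (fine_ge0 q0))%:num%:E by rewrite /= fineK.
pose m2 := pushforward (mscale (NngNum (fine_ge0 q0)) Pr) f.
have m12 : forall X, measurable X -> m1 X = m2 X.
  apply: (@product_measure_ext _ _ _ _ _ m1 m2).
    rewrite /m1 /= /pushforward /mrestr /=.
    apply: (@le_lt_trans _ _ 1%E); last by rewrite ltry.
    by apply: probability_le1; rewrite preimage_setT setTI.
  move=> A1 A2 mA1 mA2.
  rewrite /m1 /m2 /= /pushforward /mrestr /mscale /=.
  rewrite (_ : f @^-1` (A1 `*` A2) = walk l @^-1` A1 `&` Z i @^-1` A2) //.
  by rewrite rectE// rect// muleC fineK.
pose X := (fun p : U * V => step p.1 p.2) @^-1` B.
have mX : measurable X by rewrite -[X]setTI; exact: mstep.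
have := m12 X mX.
rewrite /m1 /m2 /= /pushforward /mrestr /mscale /= fineK// muleC.
by [].
Qed.

(** The Markov property of the recursion: the last draw can be integrated out
under [mu] with the previous state fixed. *)
Lemma walk_cons_integral (mu : probability V R) i l (g : U -> \bar R) :
  uniq (i :: l) -> {subset i :: l <= I} -> has_law (Z i) mu ->
  measurable_fun [set: U] g -> (forall u, 0 <= g u)%E ->
  (\int[Pr]_w g (walk (i :: l) w) = \int[Pr]_w \int[mu]_y g (step (walk l w) y))%E.
Proof.
move=> /= /andP[il ul] lI lawi mg g0.
have iI : i \in I by apply: lI; rewrite mem_head.
have lI' : {subset l <= I} by move=> j jl; apply: lI; rewrite in_cons jl orbT.
pose f w := (walk l w, Z i w).
have mf : measurable_fun setT f by exact: measurable_fun_pair.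
pose h (p : U * V) := g (step p.1 p.2).
have mh : measurable_fun setT h by exact: measurableT_comp.
have fE : forall X, measurable X ->
    (distribution Pr (walk l) \x mu)%E X = pushforward Pr f X.
  apply: product_measure_unique => A1 A2 mA1 mA2.
  have H : Pr (walk l @^-1` A1 `&` Z i @^-1` A2) =
      (distribution Pr (walk l) A1 * distribution Pr (Z i) A2)%E.
    have := @walk_independent l [set i]%SET A1 (fun=> A2) ul lI'.
    rewrite big_set1 (_ : [set` [set i]%SET] = [set i]); last first.
      by apply/seteqP; split => j /=; rewrite inE => /eqP.
    rewrite bigcap_set1; apply => //; first by rewrite finset.sub1set.
    by move=> j jl; rewrite inE; apply: contraNneq il => <-.
  by rewrite lawi// in H.
transitivity (\int[pushforward Pr f]_p h p)%E.
  by rewrite ge0_integral_pushforward// => p _; exact: g0.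
transitivity (\int[distribution Pr (walk l) \x mu]_p h p)%E.
  by apply: eq_measure_integral => A mA _; exact/esym/fE.
rewrite fubini_tonelli1//=; last by move=> p; exact: g0.
rewrite ge0_integral_distribution//.
- by apply: measurable_fun_fubini_tonelli_F => // p; exact: g0.
- by move=> u; apply: integral_ge0 => y _; exact: g0.
Qed.

Lemma walk_supermultiplicative (mu : probability V R) l (g : U -> R) (K : R) :
  uniq l -> {subset l <= I} -> (forall i, i \in I -> has_law (Z i) mu) ->
  measurable_fun setT g -> (forall u, 0 <= g u) -> 0 <= K ->
  (forall u, \int[mu]_y (g (step u y))%:E <= (K * g u)%:E)%E ->
  (\int[Pr]_w (g (walk l w))%:E <= (K ^+ size l * g u0)%:E)%E.
Proof.
move=> + + lawZ mg g0 K0 gK.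
have mgE : measurable_fun setT (fun u : U => (g u)%:E) by exact/measurable_EFinP.
elim: l => [|i l IH].
  move=> _ _ /=; rewrite mul1r integral_cst//.
  by rewrite [X in (_ * X)%E](probability_setT Pr) mule1.
move=> uil lI.
have ul : uniq l by case/andP: uil.
have lI' : {subset l <= I} by move=> j jl; apply: lI; rewrite in_cons jl orbT.
have iI : i \in I by apply: lI; rewrite mem_head.
rewrite (walk_cons_integral (mu := mu) (g := fun u => (g u)%:E))//; last first.
  exact: lawZ.
apply: (@le_trans _ _ (\int[Pr]_w (K%:E * (g (walk l w))%:E))%E).
  apply: ge0_le_integral => //.
  - by move=> w _; apply: integral_ge0 => y _; rewrite lee_fin.
  - apply: (measurableT_comp (f := fubini_F mu
      (fun p : U * V => (g (step p.1 p.2))%:E))).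
      apply: measurable_fun_fubini_tonelli_F.
        by apply: (measurableT_comp mgE).
      by move=> p; rewrite lee_fin.
    exact: measurable_walk.
  - apply: emeasurable_funM => //.
    by apply: (measurableT_comp mgE); exact: measurable_walk.
rewrite ge0_integralZl//; last 2 first.
- by apply: (measurableT_comp mgE); exact: measurable_walk.
- by move=> w _; rewrite lee_fin.
apply: le_trans (lee_wpmul2l _ (IH ul lI')) _; first by rewrite lee_fin.
by rewrite -EFinM exprS mulrA.
Qed.

End walk.

(** * Concentration of functions with bounded differences *)

Section carrier.
Context dV (V : measurableType dV) (R : realType) (mu : probability V R).
Variable D : set V.
Hypotheses (mD : measurable D) (muD : mu D = 1%E).

Lemma carrier_nonempty : exists y, D y.
Proof.
apply: contrapT => nD.
have D0 : D = set0 by apply/seteqP; split => // y Dy; apply: nD; exists y.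
by move: muD; rewrite D0 measure0 => /eqP; rewrite eqe eq_sym oner_eq0.
Qed.

Lemma integral_carrier (f : V -> \bar R) :
  measurable_fun setT f -> (forall y, 0 <= f y)%E ->
  (\int[mu]_y f y = \int[mu]_(y in D) f y)%E.
Proof.
move=> mf f0.
have mDC : measurable (~` D) by exact: measurableC.
rewrite -(setUv D) ge0_integral_setU//; last 2 first.
- by rewrite setUv.
- by apply/disj_setPCl.
have muDC : mu (~` D) = 0%E by rewrite probability_setC// muD subee.
rewrite (null_set_integral mDC) ?adde0//.
exact: measurable_funS mf.
Qed.

Lemma integrable_carrier (g : V -> R) a b :
  measurable_fun setT g -> (forall y, D y -> a <= g y <= b) ->
  mu.-integrable D (EFin \o g).
Proof.
move=> mg gab; apply: measurable_bounded_integrable => //.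
- exact: le_lt_trans (probability_le1 mu mD) (ltry 1).
- exact: measurable_funS mg.
- exists (`|a| + `|b|); split; first exact: num_real.
  move=> M abM y /= Dy; apply: le_trans (ltW abM).
  have /andP[ag gb] := gab _ Dy.
  rewrite ler_norml; apply/andP; split.
    apply: le_trans ag; rewrite opprD -[leRHS]addr0 lerD ?oppr_le0//.
    by rewrite lerNl -normrN ler_norm.
  by apply: (le_trans gb); rewrite ler_wpDl// ler_norm.
Qed.

Lemma integrable_affine (g : V -> R) (al be : R) :
  mu.-integrable D (EFin \o g) ->
  mu.-integrable D (EFin \o (fun y => al + be * g y)).
Proof.
move=> ig.
have ial : mu.-integrable D (EFin \o (fun=> al)).
  by apply: (@integrable_carrier _ al al) => // y _; rewrite lexx.
have ibe := integrableZl mD be ig.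
apply: eq_integrable (integrableD mD ial ibe) => //.
Qed.

Lemma Rintegral_const (c : R) : \int[mu]_(y in D) c = c.
Proof. by rewrite Rintegral_cst// [fine _](_ : _ = 1) ?mulr1// -[RHS]/(fine 1%E) -muD. Qed.

Lemma Rintegral_affine (g : V -> R) (al be : R) :
  mu.-integrable D (EFin \o g) ->
  \int[mu]_(y in D) (al + be * g y) = al + be * \int[mu]_(y in D) g y.
Proof.
move=> ig.
have ial : mu.-integrable D (EFin \o (fun=> al)).
  by apply: (@integrable_carrier _ al al) => // y _; rewrite lexx.
have ibe : mu.-integrable D (EFin \o (fun y => be * g y)).
  by apply: eq_integrable (integrableZl mD be ig).
by rewrite RintegralD// RintegralZl// Rintegral_const.
Qed.

(** Hoeffding's lemma: convexity bounds the exponential by its chord on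
[[a, a + c]], which reduces to a two-point law. *)
Lemma hoeffding (g : V -> R) (a c lam : R) :
  measurable_fun setT g -> 0 < c -> 0 <= lam ->
  (forall y, D y -> a <= g y <= a + c) ->
  \int[mu]_(y in D) expR (lam * g y) <=
  expR (lam * \int[mu]_(y in D) g y + (lam * c) ^+ 2 / 8).
Proof.
move=> mg c0 lam0 gac.
have ig := integrable_carrier mg gac.
set m := \int[mu]_(y in D) g y.
pose be := expR (lam * a) * (expR (lam * c) - 1) / c.
pose al := expR (lam * a) - be * a.
have mexp : measurable_fun setT (fun y => expR (lam * g y)).
  by apply: measurableT_comp => //; exact: measurable_funM.
have iexp : mu.-integrable D (EFin \o (fun y => expR (lam * g y))).
  apply: (@integrable_carrier _ 0 (expR (lam * (a + c)))) => // y Dy.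
  have /andP[_ gb] := gac _ Dy.
  by rewrite expR_ge0/= ler_expR ler_wpM2l.
have am : a <= m.
  rewrite -[leLHS]Rintegral_const; apply: le_Rintegral => //.
    by apply: (@integrable_carrier _ a a) => // y _; rewrite lexx.
  by move=> y /gac /andP[].
have mc : m <= a + c.
  rewrite -[leRHS]Rintegral_const; apply: le_Rintegral => //.
    by apply: (@integrable_carrier _ (a + c) (a + c)) => // y _; rewrite lexx.
  by move=> y /gac /andP[].
apply: (@le_trans _ _ (al + be * m)).
  rewrite -Rintegral_affine//; apply: le_Rintegral => //.
    exact: integrable_affine.
  move=> y Dy.
  have /andP[ag gb] := gac _ Dy.
  have t01 : 0 <= (g y - a) / c <= 1.
    rewrite ler_pdivrMr// mul1r lerBlDl gb andbT.
    by rewrite divr_ge0// ?subr_ge0// ltW.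
  rewrite (_ : lam * g y = lam * a + (g y - a) / c * (lam * c)); last first.
    by field; rewrite gt_eqF.
  rewrite expRD.
  apply: le_trans (ler_wpM2l (expR_ge0 _) (expR_chord _ t01)) _.
  rewrite le_eqVlt; apply/predU1P; left; rewrite /al /be.
  by field; rewrite gt_eqF.
have p01 : 0 <= (m - a) / c <= 1.
  rewrite ler_pdivrMr// mul1r lerBlDl mc andbT.
  by rewrite divr_ge0// ?subr_ge0// ltW.
have lc0 : 0 <= lam * c by rewrite mulr_ge0// ltW.
rewrite (_ : lam * m + _ =
  lam * a + ((m - a) / c * (lam * c) + (lam * c) ^+ 2 / 8)); last first.
  by field; rewrite gt_eqF.
rewrite [leRHS]expRD.
apply: le_trans (ler_wpM2l (expR_ge0 _) (hoeffding_bernoulli p01 lc0)).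
rewrite le_eqVlt; apply/predU1P; left; rewrite /al /be.
by field; rewrite gt_eqF.
Qed.

End carrier.

Lemma exponential_markov dO (Omega : measurableType dO) (R : realType)
    (Pr : probability Omega R) (X : Omega -> R) (a : R) :
  measurable_fun setT X ->
  (Pr [set w | (a <= X w)%R] <= \int[Pr]_w (expR (X w))%:E * (expR (- a))%:E)%E.
Proof.
move=> mX.
pose X' : {RV Pr >-> R} := mfun_Sub (mem_set mX : X \in mfun).
have := @chernoff _ _ _ Pr X' 1 a ltr01.
rewrite mul1r /mmt_gen_fun unlock /=.
by under eq_integral do rewrite /= mulr1.
Qed.

Section bounded_differences.
Context dV (V : measurableType dV) (R : realType) (mu : probability V R).
Variable D : set V.
Hypotheses (mD : measurable D) (muD : mu D = 1%E).
Context dU (U : measurableType dU).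
Variable step : U -> V -> U.
Hypothesis mstep : measurable_fun setT (fun p : U * V => step p.1 p.2).
Hypothesis stepC : forall u y z, step (step u y) z = step (step u z) y.

Definition average (phi : U -> R) (u : U) : R := \int[mu]_(y in D) phi (step u y).

(** Since [y] and [y'] can be exchanged the bound is two-sided. Nonnegativity makes
Tonelli's theorem applicable to the averages. *)
Definition bounded_differences (c : R) (phi : U -> R) : Prop :=
  [/\ measurable_fun setT phi, forall u, 0 <= phi u &
      forall u y y', D y -> D y' -> phi (step u y) <= phi (step u y') + c].

Lemma measurable_step_r u : measurable_fun setT (step u).
Proof.
rewrite (_ : step u = (fun p : U * V => step p.1 p.2) \o pair u) //.
exact: measurableT_comp.
Qed.

Variable c : R.

(** The oscillation bound gives an interval of length [c], as Hoeffding's lemma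
needs, with no loss of a factor two. *)
Lemma bounded_differences_range phi u : bounded_differences c phi ->
  exists a, forall y, D y -> a <= phi (step u y) <= a + c.
Proof.
move=> [mphi phi0 phic].
have [y0 Dy0] := carrier_nonempty muD.
pose A := [set phi (step u y) | y in D].
have A0 : A !=set0 by exists (phi (step u y0)); exists y0.
have hA : has_inf A by split => //; exists 0 => _ [y _ <-].
exists (inf A) => y Dy; apply/andP; split.
  by apply: ge_inf; [case: hA|exists y].
rewrite -lerBlDr; apply: lb_le_inf => // _ [y' Dy' <-].
by rewrite lerBlDr phic.
Qed.

Lemma bounded_differences_integrable phi u : bounded_differences c phi ->
  mu.-integrable D (EFin \o (fun y => phi (step u y))).
Proof.
move=> bphi; have [a ha] := bounded_differences_range u bphi.
apply: integrable_carrier ha => //.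
case: bphi => mphi _ _.
by apply: measurableT_comp => //; exact: measurable_step_r.
Qed.

Lemma measurable_average (phi : U -> R) : measurable_fun setT phi -> (forall u, 0 <= phi u) ->
  measurable_fun setT (average phi).
Proof.
move=> mphi phi0.
pose h (p : U * V) : \bar R := (phi (step p.1 p.2))%:E.
have mh : measurable_fun setT h.
  by apply/measurable_EFinP; exact: measurableT_comp.
rewrite (_ : average phi = fine \o fubini_F mu h); last first.
  apply/funext => u; rewrite /average /Rintegral /= /fubini_F /h /=.
  rewrite (integral_carrier mD muD)//; last by move=> y; rewrite lee_fin.
  apply/measurable_EFinP; apply: measurableT_comp => //.
  exact: measurable_step_r.
apply: measurableT_comp; first exact: fine_measurable.
by apply: measurable_fun_fubini_tonelli_F => // p; rewrite lee_fin.
Qed.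

(** Draws commute, so changing one draw before averaging over the next one
changes the average no more than it changes the integrand. *)
Lemma average_bounded_differences phi : bounded_differences c phi ->
  bounded_differences c (average phi).
Proof.
move=> bphi; have [mphi phi0 phic] := bphi; split.
- exact: measurable_average.
- by move=> u; apply: Rintegral_ge0.
- move=> u y y' Dy Dy'.
  have i1 := bounded_differences_integrable (step u y) bphi.
  have i2 := bounded_differences_integrable (step u y') bphi.
  have := Rintegral_affine mD muD c 1 i2; rewrite mul1r addrC => <-.
  apply: le_Rintegral => //; first exact: integrable_affine.
  by move=> z Dz; rewrite mul1r addrC !(stepC _ _ z) phic.
Qed.

Lemma average_expR phi lam u : bounded_differences c phi -> 0 < c -> 0 <= lam ->
  (\int[mu]_y (expR (lam * phi (step u y)))%:E <=
   (expR (lam * average phi u) * expR ((lam * c) ^+ 2 / 8))%:E)%E.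
Proof.
move=> bphi c0 lam0; have [mphi phi0 phic] := bphi.
have [a ha] := bounded_differences_range u bphi.
have ms : measurable_fun setT (fun y => phi (step u y)).
  by apply: measurableT_comp => //; exact: measurable_step_r.
have mexp : measurable_fun setT (fun y => expR (lam * phi (step u y))).
  by apply: measurableT_comp => //; exact: measurable_funM.
rewrite (integral_carrier mD muD); last 2 first.
- exact/measurable_EFinP.
- by move=> y; rewrite lee_fin expR_ge0.
have iexp : mu.-integrable D (EFin \o (fun y => expR (lam * phi (step u y)))).
  apply: (@integrable_carrier _ _ _ _ _ mD _ 0 (expR (lam * (a + c)))) => //.
  by move=> y /ha /andP[_ yb]; rewrite expR_ge0/= ler_expR ler_wpM2l.
rewrite -expRD -[X in (X <= _)%E]fineK ?lee_fin; last exact: integrable_fin_num.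
exact: (hoeffding mD muD ms c0 lam0 ha).
Qed.

Context dO (Omega : measurableType dO) (Pr : probability Omega R) (n : nat).
Variables (I : {set 'I_n}) (Z : 'I_n -> {RV Pr >-> V}).
Hypothesis indZ : mutually_independent I Z.
Hypothesis lawZ : forall i, i \in I -> has_law (Z i) mu.
Variable u0 : U.

(** Each draw integrated out replaces [phi] by its average, at the price of one
factor from Hoeffding's lemma. *)
Lemma walk_expR lam l phi : uniq l -> {subset l <= I} ->
  bounded_differences c phi -> 0 < c -> 0 <= lam ->
  (\int[Pr]_w (expR (lam * phi (walk Z step u0 l w)))%:E <=
   (expR (lam * iter (size l) average phi u0 +
          (size l)%:R * ((lam * c) ^+ 2 / 8)))%:E)%E.
Proof.
move=> + + + c0 lam0; elim: l phi => [|i l IH] phi.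
  move=> _ _ _ /=; rewrite mul0r addr0 integral_cst//.
  by rewrite [X in (_ * X)%E](probability_setT Pr) mule1.
move=> uil lI bphi; have [mphi phi0 phic] := bphi.
have bavg := average_bounded_differences bphi.
have [mavg _ _] := bavg.
have ul : uniq l by case/andP: uil.
have lI' : {subset l <= I} by move=> j jl; apply: lI; rewrite in_cons jl orbT.
have iI : i \in I by apply: lI; rewrite mem_head.
have mexp psi : measurable_fun setT psi ->
    measurable_fun setT (fun u : U => (expR (lam * psi u))%:E).
  move=> mpsi; apply/measurable_EFinP; apply: measurableT_comp => //.
  exact: measurable_funM.
rewrite (walk_cons_integral indZ u0 mstep (mu := mu) (i := i) (l := l)
  (g := fun u => (expR (lam * phi u))%:E))//; last 2 first.
- exact: lawZ.
- exact: mexp.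
apply: (@le_trans _ _ (\int[Pr]_w ((expR ((lam * c) ^+ 2 / 8))%:E *
    (expR (lam * average phi (walk Z step u0 l w)))%:E))%E).
  apply: ge0_le_integral => //.
  - by move=> w _; apply: integral_ge0 => y _; rewrite lee_fin expR_ge0.
  - apply: (measurableT_comp (f := fubini_F mu
      (fun p : U * V => (expR (lam * phi (step p.1 p.2)))%:E))).
      apply: measurable_fun_fubini_tonelli_F.
        by apply: (measurableT_comp (mexp _ mphi)).
      by move=> p; rewrite lee_fin expR_ge0.
    exact: measurable_walk.
  - apply: emeasurable_funM => //.
    apply: (measurableT_comp (mexp _ mavg)).
    exact: measurable_walk.
  - by move=> w _; rewrite -EFinM mulrC; exact: average_expR.
rewrite ge0_integralZl//; last first.
  by apply: (measurableT_comp (mexp _ mavg)); exact: measurable_walk.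
apply: le_trans (lee_wpmul2l _ (IH _ ul lI' bavg)) _.
  by rewrite lee_fin expR_ge0.
rewrite -EFinM -expRD lee_fin ler_expR /size -/size -iterSr.
rewrite -[(size l).+1]addn1 natrD.
by rewrite le_eqVlt; apply/predU1P; left; ring.
Qed.

(** The iterated average is the mean of [phi] at the end of the recursion; the
recursion may have fewer than [N] steps. *)
Lemma mcdiarmid N t l phi : uniq l -> {subset l <= I} ->
  (size l <= N)%N -> (0 < N)%N -> bounded_differences c phi -> 0 < c -> 0 <= t ->
  (Pr [set w | iter (size l) average phi u0 + t < phi (walk Z step u0 l w)]%R <=
   (expR (- (2 * t ^+ 2 / (N%:R * c ^+ 2))))%:E)%E.
Proof.
move=> ul lI lN N0 bphi c0 t0; have [mphi phi0 phic] := bphi.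
set M := iter _ _ _ _.
have NR : 0 < N%:R :> R by rewrite ltr0n.
(* The minimiser of [lam^2 c^2 N / 8 - lam t]. *)
pose lam := 4 * t / (N%:R * c ^+ 2).
have lam0 : 0 <= lam by rewrite divr_ge0 ?mulr_ge0 ?sqr_ge0// ltW.
have mX : measurable_fun setT (fun w => lam * phi (walk Z step u0 l w)).
  apply: measurable_funM => //; apply: measurableT_comp => //.
  exact: measurable_walk.
have mphiw : measurable_fun setT (fun w => phi (walk Z step u0 l w)).
  by apply: measurableT_comp => //; exact: measurable_walk.
apply: (@le_trans _ _ (Pr [set w | lam * (M + t) <= lam * phi (walk Z step u0 l w)]%R)).
  apply: le_measure; rewrite ?inE//.
  - rewrite -[X in measurable X]setTI.
    by apply: (measurable_fun_ltr (f := cst (M + t))) => //.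
  - rewrite -[X in measurable X]setTI.
    by apply: (measurable_fun_ler (f := cst (lam * (M + t)))) => //.
  - by move=> w /= /ltW; exact: ler_wpM2l.
apply: le_trans (exponential_markov _ _ mX) _.
apply: le_trans (lee_wpmul2r _ (walk_expR ul lI bphi c0 lam0)) _.
  by rewrite lee_fin expR_ge0.
rewrite -EFinM -expRD lee_fin ler_expR -/M.
apply: (@le_trans _ _ (N%:R * ((lam * c) ^+ 2 / 8) - lam * t)).
  rewrite mulrDr opprD [leLHS](_ : _ =
    (size l)%:R * ((lam * c) ^+ 2 / 8) - lam * t); last by ring.
  by rewrite lerD2r ler_wpM2r ?ler_nat// divr_ge0 ?sqr_ge0.
rewrite le_eqVlt; apply/predU1P; left; rewrite /lam; field.
by rewrite !gt_eqF.
Qed.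

End bounded_differences.

Section lyapunov.
Context dV (V : measurableType dV) (R : realType) (mu : probability V R).
Variable D : set V.
Hypotheses (mD : measurable D) (muD : mu D = 1%E).
Context dU (U : measurableType dU).
Variable step : U -> V -> U.
Hypothesis mstep : measurable_fun setT (fun p : U * V => step p.1 p.2).
Hypothesis stepC : forall u y z, step (step u y) z = step (step u z) y.

(** A function that grows by at most [b] on average at each step controls the
iterated averages, hence the mean in the bounded differences inequality. *)
Lemma iter_average_lyapunov (c : R) (phi Q : U -> R) (be b : R) N u :
  bounded_differences D step c phi ->
  (forall u, phi u <= Q u + be) ->
  (forall u, mu.-integrable D (EFin \o (fun y => Q (step u y)))) ->
  (forall u, average mu D step Q u <= Q u + b) ->
  iter N (average mu D step) phi u <= Q u + be + N%:R * b.
Proof.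
move=> bphi phiQ iQ aQ.
elim: N phi be bphi phiQ => [|N IH] phi be bphi phiQ.
  by rewrite mul0r addr0.
rewrite iterSr.
apply: le_trans (IH _ (be + b) (average_bounded_differences mD muD mstep stepC bphi) _) _.
  move=> v.
  apply: (@le_trans _ _ (be + average mu D step Q v)).
    rewrite /average -[X in _ + X]mul1r -Rintegral_affine//.
    apply: le_Rintegral => //.
    - exact: bounded_differences_integrable bphi.
    - exact: integrable_affine.
    - by move=> y _; rewrite mul1r addrC.
  by rewrite (addrCA (Q v)) lerD2l; apply: aQ.
by rewrite -addn1 natrD le_eqVlt; apply/predU1P; left; ring.
Qed.

End lyapunov.

(** * Sums of independent points of the simplex *)

Section simplex_mean.
Context (R : realType) (k : nat).
Implicit Types (y m : k.-tuple R) (mu : probability (k.-tuple R) R).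

Lemma measurable_coordinate_sum (B : {set 'I_k}) :
  measurable_fun setT (fun y : k.-tuple R => \sum_(j in B) tnth y j).
Proof.
rewrite [X in measurable_fun _ X](_ : _ =
  fun y : k.-tuple R => \sum_j (if j \in B then tnth y j else 0)); last first.
  by apply/funext => y; rewrite big_mkcond.
apply: measurable_sum => j.
by case: (j \in B); [exact: measurable_tnth|exact: measurable_cst].
Qed.

Lemma measurable_simplex : measurable (@simplex R k).
Proof.
rewrite (_ : @simplex R k =
  (\bigcap_(j in [set: 'I_k]) ((fun y : k.-tuple R => tnth y j) @^-1` `[0, +oo[)) `&`
  ((fun y : k.-tuple R => \sum_(j < k) tnth y j) @^-1` [set 1])).
  apply: measurableI.
    apply: fin_bigcap_measurable => // j _.
    by rewrite -[_ @^-1` _]setTI; apply: measurable_tnth.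
  rewrite -[_ @^-1` _]setTI.
  have ms : measurable_fun setT (fun y : k.-tuple R => \sum_(j < k) tnth y j).
    by apply: measurable_sum => j; exact: measurable_tnth.
  exact: ms.
apply/seteqP; split => y.
  move=> [y0 y1]; split => // j _ /=.
  by rewrite in_itv/= y0.
move=> [y0 y1]; split => // j; have := y0 j I.
by rewrite /= in_itv/= andbT.
Qed.

Lemma simplex_le1 y j : simplex y -> tnth y j <= 1.
Proof.
move=> [y0 <-]; rewrite (bigD1 j)//= lerDl.
by apply: sumr_ge0.
Qed.

Lemma simplex_sum_le1 y (B : {set 'I_k}) : simplex y ->
  0 <= \sum_(j in B) tnth y j <= 1.
Proof.
move=> [y0 y1]; rewrite sumr_ge0//= -y1 [leRHS](bigID (mem B))/= lerDl.
by apply: sumr_ge0.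
Qed.

Variables (mu : probability (k.-tuple R) R) (m : k.-tuple R).
Hypothesis muD : on_simplex mu.

Lemma integrable_coordinate j :
  mu.-integrable (@simplex R k) (EFin \o (fun y => tnth y j)).
Proof.
apply: (integrable_carrier _ measurable_simplex (a := 0) (b := 1)).
  exact: measurable_tnth.
by move=> y sy; rewrite simplex_le1// andbT; case: sy.
Qed.

Lemma integral_coordinate_carrier j :
  (\int[mu]_y (tnth y j)%:E = \int[mu]_(y in @simplex R k) (tnth y j)%:E)%E.
Proof.
rewrite [RHS]integral_mkcond.
have mt : measurable_fun setT (fun y : k.-tuple R => (tnth y j)%:E).
  by apply/measurable_EFinP; exact: measurable_tnth.
have muC : mu (~` @simplex R k) = 0%E.
  rewrite probability_setC; last exact: measurable_simplex.
  by rewrite (muD : mu _ = 1%E) subee.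
apply: (@ae_eq_integral _ _ _ mu setT) => //.
- apply: (proj1 (measurable_restrictT _ measurable_simplex)).
  exact: measurable_funS mt.
- exists (~` @simplex R k); split.
  + by apply: measurableC; exact: measurable_simplex.
  + exact: muC.
  + move=> y /= H sy; apply: H => _.
    by rewrite patchE mem_set.
Qed.

Hypothesis mum : has_mean mu m.

Lemma Rintegral_coordinate j : \int[mu]_(y in @simplex R k) tnth y j = tnth m j.
Proof.
have := mum j; rewrite unlock /Rintegral => mj.
by rewrite -integral_coordinate_carrier mj.
Qed.

Lemma Rintegral_linear (a : R) (b : 'I_k -> R) :
  mu.-integrable (@simplex R k)
    (EFin \o (fun y => a + \sum_(j < k) b j * tnth y j)) /\
  \int[mu]_(y in @simplex R k) (a + \sum_(j < k) b j * tnth y j) =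
  a + \sum_(j < k) b j * tnth m j.
Proof.
have mD := measurable_simplex.
elim: (index_enum 'I_k) a => [|j r IH] a.
  have -> : (fun y : k.-tuple R => a + \sum_(j <- [::]) b j * tnth y j) = fun=> a.
    by apply/funext => y; rewrite big_nil addr0.
  rewrite big_nil addr0; split.
    by apply: (@integrable_carrier _ _ _ _ _ mD _ a a) => // y _; rewrite lexx.
  exact: Rintegral_const.
have [i1 e1] := IH a.
have i2 := integrable_affine mD 0 (b j) (integrable_coordinate j).
have e2 := Rintegral_affine mD muD 0 (b j) (integrable_coordinate j).
have E y : a + \sum_(i <- j :: r) b i * tnth y i =
    (a + \sum_(i <- r) b i * tnth y i) + (0 + b j * tnth y j).
  by rewrite big_cons; ring.
split.
  rewrite (_ : _ \o _ = EFin \o (fun y => (a + \sum_(i <- r) b i * tnth y i) +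
    (0 + b j * tnth y j))); last by apply/funext => y /=; rewrite E.
  by apply: eq_integrable (integrableD mD i1 i2).
under eq_Rintegral do rewrite E.
by rewrite RintegralD// e1 e2 Rintegral_coordinate E.
Qed.

Lemma mean_simplex : simplex m.
Proof.
split=> [j|].
  by rewrite -Rintegral_coordinate; apply: Rintegral_ge0 => y [y0 _].
transitivity (0 + \sum_(j < k) 1 * tnth m j).
  by rewrite add0r; apply: eq_bigr => j _; rewrite mul1r.
rewrite -(Rintegral_linear 0 (fun=> 1)).2.
rewrite -[RHS](Rintegral_const measurable_simplex muD).
apply: eq_Rintegral => y; rewrite inE => -[_ y1].
by rewrite add0r -[RHS]y1; apply: eq_bigr => j _; rewrite mul1r.
Qed.

End simplex_mean.

Section deviation.
Context (R : realType) (k : nat).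
Variable m : k.-tuple R.

(** Centring at each step keeps the second moment of the state growing by at
most one per draw. *)
Definition centred_add (s y : k.-tuple R) : k.-tuple R :=
  [tuple tnth s j + (tnth y j - tnth m j) | j < k].

Definition zero_tuple : k.-tuple R := [tuple 0 | j < k].

Lemma measurable_centred_add :
  measurable_fun setT (fun p : k.-tuple R * k.-tuple R => centred_add p.1 p.2).
Proof.
apply/measurable_fun_tnthP => j.
under [X in measurable_fun _ X]eq_fun do rewrite /= tnth_mktuple.
apply: measurable_funD.
  by apply: (measurableT_comp (measurable_tnth j)).
apply: measurable_funB => //.
by apply: (measurableT_comp (measurable_tnth j)).
Qed.

Lemma centred_addC s y z :
  centred_add (centred_add s y) z = centred_add (centred_add s z) y.
Proof. by apply: eq_from_tnth => j; rewrite !tnth_mktuple; ring. Qed.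

Definition sqnorm (s : k.-tuple R) := \sum_(j < k) tnth s j ^+ 2.

Variable mu : probability (k.-tuple R) R.
Hypotheses (muD : on_simplex mu) (mum : has_mean mu m).

Lemma measurable_sqnorm : measurable_fun setT sqnorm.
Proof.
apply: measurable_sum => j; apply: measurable_funX; exact: measurable_tnth.
Qed.

Lemma integrable_sqnorm s :
  mu.-integrable (@simplex R k) (EFin \o (fun y => sqnorm (centred_add s y))).
Proof.
have mm := mean_simplex muD mum.
apply: (@integrable_carrier _ _ _ mu _ (@measurable_simplex R k)
  (fun y => sqnorm (centred_add s y)) 0 (\sum_(j < k) (`|tnth s j| + 1) ^+ 2)).
  apply: (measurableT_comp measurable_sqnorm).
  by apply: measurable_step_r; exact: measurable_centred_add.
move=> y sy; rewrite sumr_ge0/=; last by move=> j _; exact: sqr_ge0.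
apply: ler_sum => j _; rewrite tnth_mktuple -[leLHS]ger0_norm ?sqr_ge0// normrX.
rewrite lerXn2r ?nnegrE ?addr_ge0//.
apply: le_trans (ler_normD _ _) _; rewrite lerD2l ler_norml.
have [[y0 _] [m0 _]] := (sy, mm).
have := simplex_le1 j sy; have := simplex_le1 j mm.
have := y0 j; have := m0 j; lra.
Qed.

(** On the simplex [y_j^2 <= y_j], so the integrand is at most an affine function of
[y], whose integral is explicit. *)
Lemma average_sqnorm s :
  average mu (@simplex R k) centred_add sqnorm s <= sqnorm s + 1.
Proof.
have mm := mean_simplex muD mum.
pose a := \sum_(j < k) (tnth s j - tnth m j) ^+ 2.
pose b j := 2 * (tnth s j - tnth m j) + 1.
have [il el] := Rintegral_linear muD mum a b.
apply: (@le_trans _ _ (a + \sum_(j < k) b j * tnth m j)).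
  rewrite -el; apply: le_Rintegral => //; first exact: measurable_simplex.
    exact: integrable_sqnorm.
  move=> y sy; rewrite /sqnorm /a -big_split/=; apply: ler_sum => j _.
  rewrite tnth_mktuple -subr_ge0 /b.
  rewrite (_ : _ - _ = tnth y j * (1 - tnth y j)); last by ring.
  by rewrite mulr_ge0 ?subr_ge0 ?simplex_le1//; case: sy.
have [m0 m1] := mm.
rewrite /a -big_split/= -m1 /sqnorm -big_split/=; apply: ler_sum => j _.
rewrite -subr_ge0 (_ : _ - _ = tnth m j ^+ 2) ?sqr_ge0// /b; ring.
Qed.

End deviation.

(** * Deviations in the Euclidean norm and in missing mass *)

Section norms.
Context (R : realType) (k : nat).
Variable m : k.-tuple R.

Definition l2norm (s : k.-tuple R) := Num.sqrt (sqnorm s).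

(** At [n (u - q)] this is [n] times the mass that [u] lacks in [S] compared with
[q]. *)
Definition deficit (S : {set 'I_k}) (s : k.-tuple R) :=
  \sum_(j in S) Num.max 0 (- tnth s j).

Lemma measurable_sqrt : measurable_fun setT (@Num.sqrt R).
Proof. by apply: continuous_measurable_fun; exact: sqrt_continuous. Qed.

(** Two points of the simplex are at Euclidean distance at most [sqrt 2]. *)
Lemma l2norm_bounded_differences :
  bounded_differences (@simplex R k) (centred_add m) (Num.sqrt 2) l2norm.
Proof.
split.
- by apply: (measurableT_comp measurable_sqrt); exact: measurable_sqnorm.
- by move=> s; exact: sqrtr_ge0.
move=> s y y' [y0 y1] [y'0 y'1].
rewrite /l2norm /sqnorm.
have sy' := conj y'0 y'1 : simplex y'; have sy := conj y0 y1 : simplex y.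
apply: (@le_trans _ _ (Num.sqrt (\sum_(j < k)
    (tnth (centred_add m s y') j + (tnth y j - tnth y' j)) ^+ 2))).
  rewrite le_eqVlt; apply/predU1P; left; congr Num.sqrt.
  by apply: eq_bigr => j _; rewrite !tnth_mktuple; congr (_ ^+ 2); ring.
apply: le_trans (l2_triangle _ _ _ _) _; rewrite lerD2l ler_wsqrtr//.
rewrite (_ : 2 = \sum_(j < k) (tnth y j + tnth y' j)); last first.
  by rewrite big_split/= y1 y'1.
apply: ler_sum => j _.
have := y0 j; have := y'0 j; have := simplex_le1 j sy; have := simplex_le1 j sy'.
nra.
Qed.

(** Replacing [y'] by [y] uncovers at most the mass that [y'] has in [S]. *)
Lemma deficit_bounded_differences S :
  bounded_differences (@simplex R k) (centred_add m) 1 (deficit S).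
Proof.
split.
- rewrite [X in measurable_fun _ X](_ : _ = fun s : k.-tuple R =>
    \sum_j (if j \in S then Num.max 0 (- tnth s j) else 0)); last first.
    by apply/funext => s; rewrite /deficit big_mkcond.
  apply: measurable_sum => j.
  case: (j \in S); last exact: measurable_cst.
  apply: measurable_maxr => //.
  by apply: measurableT_comp => //; exact: measurable_tnth.
- by move=> s; apply: sumr_ge0 => j _; rewrite le_max lexx.
move=> s y y' sy sy'.
apply: (@le_trans _ _ (deficit S (centred_add m s y') + \sum_(j in S) tnth y' j)).
  rewrite /deficit -big_split/=; apply: ler_sum => j _.
  rewrite !tnth_mktuple.
  have [y0 _] := sy; have [y'0 _] := sy'; have := y0 j; have := y'0 j => a b.
  rewrite ge_max; apply/andP; split.
    by rewrite addr_ge0// le_max lexx.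
  have : - (tnth s j + (tnth y' j - tnth m j)) <=
    Num.max 0 (- (tnth s j + (tnth y' j - tnth m j))) by rewrite le_max lexx orbT.
  lra.
by rewrite lerD2l; have /andP[] := simplex_sum_le1 S sy'.
Qed.

(** A quadratic majorant tangent at norm [a] takes the place of Jensen's inequality
for the mean of the norm; likewise for the deficit. *)
Lemma l2norm_le_sqnorm (a : R) s : 0 < a -> l2norm s <= (2 * a)^-1 * sqnorm s + a / 2.
Proof.
move=> a0; rewrite /l2norm.
have q0 : 0 <= sqnorm s by rewrite sumr_ge0// => j _; rewrite sqr_ge0.
rewrite -{2}(sqr_sqrtr q0).
set x := Num.sqrt _.
rewrite -subr_ge0 (_ : _ - _ = (x - a) ^+ 2 / (2 * a)); last by field; rewrite gt_eqF.
by rewrite divr_ge0 ?sqr_ge0// mulr_ge0// ltW.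
Qed.

Lemma deficit_le_sqnorm (S : {set 'I_k}) (a : R) s : 0 < a ->
  deficit S s <= (2 * a)^-1 * sqnorm s + #|S|%:R * (a / 2).
Proof.
move=> a0.
have i0 : 0 <= (2 * a)^-1 by rewrite invr_ge0 mulr_ge0// ltW.
have h0 : 0 <= a / 2 by rewrite divr_ge0// ltW.
apply: (@le_trans _ _ (\sum_(j in S) ((2 * a)^-1 * tnth s j ^+ 2 + a / 2))).
  apply: ler_sum => j _; rewrite ge_max; apply/andP; split.
    by rewrite addr_ge0// mulr_ge0// sqr_ge0.
  rewrite -subr_ge0 (_ : _ - _ = (tnth s j + a) ^+ 2 / (2 * a)).
    by rewrite divr_ge0 ?sqr_ge0// mulr_ge0// ltW.
  by field; rewrite gt_eqF.
rewrite big_split/= -mulr_sumr sumr_const [#|S|%:R * _]mulr_natl lerD2r ler_wpM2l//.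
rewrite /sqnorm [leRHS](bigID (mem S))/= lerDl.
by rewrite sumr_ge0// => j _; rewrite sqr_ge0.
Qed.

End norms.

Section deviation_bounds.
Context (R : realType) (k n : nat).
Variables (mu : probability (k.-tuple R) R) (m : k.-tuple R).
Hypotheses (muD : on_simplex mu) (mum : has_mean mu m) (n0 : (0 < n)%N).
Context dO (Omega : measurableType dO) (Pr : probability Omega R).
Variables (I : {set 'I_n}) (Z : 'I_n -> {RV Pr >-> k.-tuple R}).
Hypothesis indZ : mutually_independent I Z.
Hypothesis lawZ : forall i, i \in I -> has_law (Z i) mu.

Definition deviation : Omega -> k.-tuple R :=
  walk Z (centred_add m) (zero_tuple R k) (enum I).

Lemma tnth_deviation w j :
  tnth (deviation w) j = \sum_(i in I) (tnth (Z i w) j - tnth m j).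
Proof.
rewrite /deviation -big_enum/=.
elim: (enum I) => [|i l IH] /=; first by rewrite big_nil tnth_mktuple.
by rewrite big_cons tnth_mktuple IH addrC.
Qed.

Lemma measurable_deviation : measurable_fun setT deviation.
Proof. by apply: measurable_walk; exact: measurable_centred_add. Qed.

Let nR : 0 < n%:R :> R. Proof. by rewrite ltr0n. Qed.
Let card_I : (#|I| <= n)%N.
Proof. by rewrite -[leqRHS]card_ord max_card. Qed.
Let enumI : {subset enum I <= I}.
Proof. by move=> i; rewrite mem_enum. Qed.

(** The second moment of the deviation is at most [n], so the quadratic majorant
[al * sqnorm + be] bounds the mean of [phi] by [al * n + be]. *)
Lemma deviation_bounded_differences (c al be t : R) (phi : k.-tuple R -> R) :
  bounded_differences (@simplex R k) (centred_add m) c phi ->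
  0 < c -> 0 <= t -> 0 <= al ->
  (forall s, phi s <= al * sqnorm s + be) ->
  (Pr [set w | al * n%:R + be + t < phi (deviation w)]%R <=
   (expR (- (2 * t ^+ 2 / (n%:R * c ^+ 2))))%:E)%E.
Proof.
move=> bphi c0 t0 al0 phiQ.
have mD := @measurable_simplex R k.
have ms := measurable_centred_add m.
have sC := centred_addC m.
have [mphi phi0 _] := bphi.
have size_le : (size (enum I) <= n)%N by rewrite -cardE.
have := mcdiarmid mD muD ms sC indZ lawZ (zero_tuple R k) (enum_uniq I)
  enumI size_le n0 bphi c0 t0.
apply: le_trans; apply: le_measure; rewrite ?inE.
- rewrite -[X in measurable X]setTI.
  apply: (measurable_fun_ltr (f := cst (al * n%:R + be + t))) => //.
  by apply: measurableT_comp => //; exact: measurable_deviation.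
- rewrite -[X in measurable X]setTI.
  apply: (measurable_fun_ltr (f := cst (_ + t))) => //.
  by apply: measurableT_comp => //; exact: measurable_deviation.
move=> w /=; apply: le_lt_trans; rewrite lerD2r.
have iQ u : mu.-integrable (@simplex R k)
    (EFin \o (fun y => al * sqnorm (centred_add m u y))).
  by apply: eq_integrable (integrableZl mD al (integrable_sqnorm muD mum u)).
apply: le_trans (iter_average_lyapunov mD muD ms sC (Q := fun s => al * sqnorm s)
  (be := be) (b := al) _ _ bphi phiQ iQ _) _.
  move=> u; rewrite /average RintegralZl//; last exact: integrable_sqnorm.
  by rewrite -[X in _ + X]mulr1 -mulrDr ler_wpM2l// average_sqnorm.
rewrite (_ : sqnorm _ = 0); last first.
  by apply: big1 => j _; rewrite tnth_mktuple expr0n.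
rewrite mulr0 add0r addrC lerD2r mulrC ler_wpM2l// ler_nat -cardE.
exact: card_I.
Qed.

(** At [a = sqrt n] the two terms bounding the mean are both [a / 2]; since [c = sqrt 2] the exponent is exactly
[ln (1 / delta)]. *)
Lemma deviation_l2norm (delta : R) : 0 < delta < 1 ->
  (Pr [set w | Num.sqrt n%:R + Num.sqrt (n%:R * ln (1 / delta)) <
               l2norm (deviation w)]%R <= delta%:E)%E.
Proof.
move=> /andP[d0 d1].
have L0 : 0 <= ln (1 / delta).
  by apply: ln_ge0; rewrite div1r invf_ge1// ltW.
set a := Num.sqrt n%:R.
have a0 : 0 < a by rewrite sqrtr_gt0.
have a2 : a ^+ 2 = n%:R by rewrite sqr_sqrtr// ltW.
have i0 : 0 <= (2 * a)^-1 by rewrite invr_ge0 mulr_ge0// ltW.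
have s20 : 0 < Num.sqrt 2 :> R by rewrite sqrtr_gt0.
have := deviation_bounded_differences (l2norm_bounded_differences m)
  s20 (sqrtr_ge0 (n%:R * ln (1 / delta))) i0 (fun s => l2norm_le_sqnorm s a0).
rewrite (sqr_sqrtr (a := 2))// sqr_sqrtr; last by rewrite mulr_ge0// ltW.
rewrite (_ : 2 * _ / _ = ln (1 / delta)); last by field; rewrite gt_eqF.
rewrite -lnV ?posrE ?divr_gt0// lnK ?posrE ?invr_gt0 ?divr_gt0// div1r invrK.
rewrite (_ : (2 * a)^-1 * n%:R + a / 2 = a)//.
by rewrite -a2; field; rewrite gt_eqF.
Qed.

(** The majorant is taken at [a = sqrt (n / s)], which balances the two terms. *)
Lemma deviation_deficit (S : {set 'I_k}) (s : nat) (delta : R) :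
  0 < delta < 1 -> (0 < s)%N -> (#|S| <= s)%N ->
  (Pr [set w | Num.sqrt (s%:R * n%:R) + Num.sqrt (2 * n%:R * ln (1 / delta)) <
               deficit S (deviation w)]%R <= delta%:E)%E.
Proof.
move=> /andP[d0 d1] s0 Ss.
have L0 : 0 <= ln (1 / delta).
  by apply: ln_ge0; rewrite div1r invf_ge1// ltW.
have sR : 0 < s%:R :> R by rewrite ltr0n.
set b := Num.sqrt (s%:R * n%:R).
have b0 : 0 < b by rewrite sqrtr_gt0 mulr_gt0.
have b2 : b ^+ 2 = s%:R * n%:R by rewrite sqr_sqrtr// mulr_ge0 ltW.
have a0 : 0 < b / s%:R by rewrite divr_gt0.
have phiQ u : deficit S u <= (2 * (b / s%:R))^-1 * sqnorm u + b / 2.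
  apply: le_trans (deficit_le_sqnorm S u a0) _; rewrite lerD2l.
  rewrite (_ : b / 2 = s%:R * (b / s%:R / 2)); last by field; rewrite gt_eqF.
  by rewrite ler_wpM2r ?ler_nat// divr_ge0// ltW.
have i0 : 0 <= (2 * (b / s%:R))^-1 by rewrite invr_ge0 mulr_ge0// ltW.
have := deviation_bounded_differences (deficit_bounded_differences m S)
  ltr01 (sqrtr_ge0 (2 * n%:R * ln (1 / delta))) i0 phiQ.
rewrite (_ : (2 * (b / s%:R))^-1 * n%:R + b / 2 = b); last first.
  rewrite (_ : n%:R = b ^+ 2 / s%:R); last by rewrite b2 mulrAC mulfV ?mul1r// gt_eqF.
  by field; rewrite !gt_eqF.
move=> /le_trans; apply; rewrite lee_fin.
rewrite sqr_sqrtr; last by rewrite !mulr_ge0// ltW.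
rewrite expr1n mulr1.
rewrite (_ : 2 * _ / _ = 4 * ln (1 / delta)); last by field; rewrite gt_eqF.
apply: (@le_trans _ _ (expR (- ln (1 / delta)))).
  by rewrite ler_expR lerN2; lra.
by rewrite -lnV ?posrE ?divr_gt0// lnK ?posrE ?invr_gt0 ?divr_gt0// div1r invrK.
Qed.

End deviation_bounds.

(** * Poisson-type tails for square roots of masses *)

Section poisson_tails.
Context (R : realType) (k n : nat).
Variables (mu : probability (k.-tuple R) R) (m : k.-tuple R).
Hypotheses (muD : on_simplex mu) (mum : has_mean mu m) (n0 : (0 < n)%N).
Context dO (Omega : measurableType dO) (Pr : probability Omega R).
Variables (I : {set 'I_n}) (Z : 'I_n -> {RV Pr >-> k.-tuple R}).
Hypothesis indZ : mutually_independent I Z.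
Hypothesis lawZ : forall i, i \in I -> has_law (Z i) mu.
Variable B : {set 'I_k}.

Definition mass (v : k.-tuple R) := \sum_(j in B) tnth v j.

(** The empirical mean in which each index outside [I] contributes [m]. *)
Definition recentred_mean w : k.-tuple R :=
  [tuple tnth m j + n%:R^-1 * tnth (deviation m I Z w) j | j < k].

Let nR : 0 < n%:R :> R. Proof. by rewrite ltr0n. Qed.

Lemma mass_centred_add s y : mass (centred_add m s y) = mass s + (mass y - mass m).
Proof.
rewrite /mass -sumrB -big_split/=.
by apply: eq_bigr => j _; rewrite tnth_mktuple.
Qed.

Lemma mass_recentred_mean w :
  mass (recentred_mean w) = mass m + n%:R^-1 * mass (deviation m I Z w).
Proof.
rewrite /mass mulr_sumr -big_split/=.
by apply: eq_bigr => j _; rewrite tnth_mktuple.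
Qed.

Lemma measurable_mass_recentred_mean :
  measurable_fun setT (fun w => mass (recentred_mean w)).
Proof.
under [X in measurable_fun _ X]eq_fun do rewrite mass_recentred_mean.
apply: measurable_funD => //; apply: measurable_funM => //.
apply: (measurableT_comp (measurable_coordinate_sum B)).
exact: measurable_deviation.
Qed.

Lemma mass_mean_ge0 : 0 <= mass m.
Proof. by have /andP[] := simplex_sum_le1 B (mean_simplex muD mum). Qed.

(** The mass lies in [[0, 1]]: the chord bound compares it with a Bernoulli variable,
which is then compared with a Poisson variable. *)
Lemma average_expR_mass (lam : R) :
  (\int[mu]_y (expR (lam * mass y))%:E <=
   (expR (mass m * (expR lam - 1)))%:E)%E.
Proof.
have mD := @measurable_simplex R k.
have mm : measurable_fun setT (fun y : k.-tuple R => expR (lam * mass y)).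
  apply: measurableT_comp => //; apply: measurable_funM => //.
  exact: measurable_coordinate_sum.
have iexp : mu.-integrable (@simplex R k) (EFin \o (fun y => expR (lam * mass y))).
  apply: (@integrable_carrier _ _ _ _ _ mD _ 0 (1 + expR lam)) => // y sy.
  have p01 := simplex_sum_le1 B sy.
  rewrite expR_ge0/= mulrC; apply: le_trans (expR_chord lam p01) _.
  have := expR_gt0 lam; have /andP[p0 p1] := p01; rewrite /mass; nra.
rewrite (integral_carrier mD muD); last 2 first.
- exact/measurable_EFinP.
- by move=> y; rewrite lee_fin expR_ge0.
rewrite -[X in (X <= _)%E]fineK ?lee_fin; last exact: integrable_fin_num.
pose b j := (expR lam - 1) * (j \in B)%:R.
have E (v : k.-tuple R) : \sum_(j < k) b j * tnth v j = (expR lam - 1) * mass v.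
  rewrite /mass [in RHS]big_mkcond/= mulr_sumr; apply: eq_bigr => j _.
  by rewrite /b; case: (j \in B); rewrite ?mulr1 ?mulr0 ?mul0r.
have [il el] := Rintegral_linear muD mum 1 b.
apply: (@le_trans _ _ (1 + \sum_(j < k) b j * tnth m j)).
  rewrite -el; apply: le_Rintegral => // y sy.
  rewrite E mulrC; apply: le_trans (expR_chord lam (simplex_sum_le1 B sy)) _.
  by rewrite le_eqVlt /mass; apply/predU1P; left; ring.
by rewrite E mulrC expR_ge1Dx.
Qed.

(** The exponential moments of [n] times the mass are at most those of a Poisson
variable of mean [n * mass m]: an index without a draw contributes the constant
[mass m], whose moments are smaller still. *)
Lemma expR_mass_recentred_mean (lam : R) :
  (\int[Pr]_w (expR (lam * (n%:R * mass (recentred_mean w))))%:E <=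
   (expR (n%:R * (mass m * (expR lam - 1))))%:E)%E.
Proof.
have p0 := mass_mean_ge0.
have e1 : 0 <= expR lam - 1 - lam.
  by rewrite subr_ge0 lerBrDl expR_ge1Dx.
pose K := expR (mass m * (expR lam - 1 - lam)).
pose g (s : k.-tuple R) := expR (lam * mass s).
have mg : measurable_fun setT g.
  apply: measurableT_comp => //; apply: measurable_funM => //.
  exact: measurable_coordinate_sum.
have gK u : (\int[mu]_y (g (centred_add m u y))%:E <= (K * g u)%:E)%E.
  rewrite (eq_integral (fun y => ((expR (lam * (mass u - mass m)))%:E *
      (expR (lam * mass y))%:E)%E)); last first.
    by move=> y _; rewrite /g mass_centred_add -EFinM -expRD; congr (expR _)%:E; ring.
  rewrite ge0_integralZl//; last first.
    apply/measurable_EFinP; apply: measurableT_comp => //; apply: measurable_funM => //.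
    exact: measurable_coordinate_sum.
  apply: le_trans (lee_wpmul2l _ (average_expR_mass lam)) _.
    by rewrite lee_fin expR_ge0.
  rewrite -EFinM lee_fin /K /g -!expRD ler_expR.
  by rewrite le_eqVlt; apply/predU1P; left; ring.
have := walk_supermultiplicative indZ (zero_tuple R k) (measurable_centred_add m)
  (enum_uniq I) _ lawZ mg (fun u => expR_ge0 _) (expR_ge0 _) gK.
move=> /(_ (fun i => _))-/(_ _); rewrite -/(deviation m I Z) => H.
under eq_integral => w _.
  rewrite (_ : expR _ = expR (lam * (n%:R * mass m)) * g (deviation m I Z w)).
    rewrite EFinM. over.
  rewrite /g -expRD mass_recentred_mean; congr expR.
  by field; rewrite gt_eqF.
rewrite ge0_integralZl//; last 2 first.
- by apply/measurable_EFinP; apply: (measurableT_comp mg); exact: measurable_deviation.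
- by move=> w _; rewrite lee_fin expR_ge0.
apply: le_trans (lee_wpmul2l _ (H _)) _.
- by rewrite lee_fin expR_ge0.
- by move=> i; rewrite mem_enum.
rewrite -EFinM lee_fin (_ : g _ = 1) ?mulr1; last first.
  by rewrite /g /mass big1 ?mulr0 ?expR0// => j _; rewrite tnth_mktuple.
rewrite -expRM_natl -expRD ler_expR.
apply: (@le_trans _ _ (lam * (n%:R * mass m) + n%:R * (mass m * (expR lam - 1 - lam)))).
  rewrite lerD2l ler_wpM2r// ?mulr_ge0// ler_nat -cardE.
  by rewrite -[leqRHS]card_ord max_card.
by rewrite le_eqVlt; apply/predU1P; left; ring.
Qed.

(** With [u = sqrt (mass m)] the optimal exponent makes [exp lam = r^2 / u^2];
the inequality [ln x >= 1 - 1/x] turns the Poisson rate function into the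
squared distance of the square roots, for either sign of [lam]. *)
Lemma chernoff_sqrt_mass (r lam : R) : 0 < r -> 0 < mass m ->
  lam = 2 * ln (r / Num.sqrt (mass m)) ->
  (Pr [set w | lam * r ^+ 2 <= lam * mass (recentred_mean w)]%R <=
   (expR (- (n%:R * (r - Num.sqrt (mass m)) ^+ 2)))%:E)%E.
Proof.
move=> r0 p0 lamE.
set u := Num.sqrt (mass m).
have u0 : 0 < u by rewrite sqrtr_gt0.
have u2 : mass m = u ^+ 2 by rewrite sqr_sqrtr// ltW.
have elam : expR lam = (r / u) ^+ 2.
  by rewrite lamE mulrC expRM_natr lnK// posrE divr_gt0.
have mX : measurable_fun setT (fun w => lam * (n%:R * mass (recentred_mean w))).
  do 2 apply: measurable_funM => //.
  exact: measurable_mass_recentred_mean.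
rewrite (_ : [set w | _] =
  [set w | lam * (n%:R * r ^+ 2) <= lam * (n%:R * mass (recentred_mean w))]%R).
  apply: le_trans (exponential_markov _ _ mX) _.
  apply: le_trans (lee_wpmul2r _ (expR_mass_recentred_mean lam)) _.
    by rewrite lee_fin expR_ge0.
  rewrite -EFinM -expRD lee_fin ler_expR.
  have lnr : 1 - u / r <= ln (r / u).
    have xr : -1 < u / r - 1 by rewrite ltrBDr addNr divr_gt0.
    have := le_ln1Dx xr; rewrite addrC subrK.
    by rewrite -[u / r]invf_div lnV ?posrE ?divr_gt0// invf_div; lra.
  rewrite elam u2.
  rewrite (_ : _ + _ = n%:R * (r ^+ 2 - u ^+ 2 - 2 * r ^+ 2 * ln (r / u))); last first.
    by rewrite lamE -/u; field; rewrite gt_eqF.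
  rewrite -[leRHS]mulrN ler_wpM2l//.
  have : 2 * r ^+ 2 * (1 - u / r) <= 2 * r ^+ 2 * ln (r / u).
    by rewrite ler_wpM2l// mulr_ge0// sqr_ge0.
  rewrite (_ : 2 * r ^+ 2 * (1 - u / r) = 2 * r ^+ 2 - 2 * r * u); last first.
    by field; rewrite gt_eqF.
  rewrite sqrrB; nra.
apply/seteqP; split => w /=; rewrite !(mulrCA lam) ler_pM2l//.
Qed.

Lemma sqrt_mass_upper_tail (x : R) : 0 < x ->
  (Pr [set w | Num.sqrt (mass m) + x < Num.sqrt (mass (recentred_mean w))]%R <=
   (expR (- (n%:R * x ^+ 2)))%:E)%E.
Proof.
move=> x0; set u := Num.sqrt (mass m).
have u0 : 0 <= u by exact: sqrtr_ge0.
have r0 : 0 < u + x by rewrite ltr_wpDl.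
have ms : measurable [set w | u + x < Num.sqrt (mass (recentred_mean w))].
  rewrite -[X in measurable X]setTI.
  apply: (measurable_fun_ltr (f := cst (u + x))) => //.
  by apply: (measurableT_comp (@measurable_sqrt R)); exact: measurable_mass_recentred_mean.
have sub w : u + x < Num.sqrt (mass (recentred_mean w)) ->
    (u + x) ^+ 2 <= mass (recentred_mean w).
  move=> H; have q0 : 0 < mass (recentred_mean w).
    by rewrite -sqrtr_gt0 (lt_trans r0).
  by rewrite -[leRHS](sqr_sqrtr (ltW q0)) lerXn2r ?nnegrE ?sqrtr_ge0 ?ltW.
(* For [mass m = 0] the exponent above degenerates; any fixed [lam] works as the
   Poisson bound is then [1]. *)
have [p0|p0] := eqVneq (mass m) 0; last first.
  have p_gt0 : 0 < mass m by rewrite lt_neqAle eq_sym p0 mass_mean_ge0.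
  have u_gt0 : 0 < u by rewrite sqrtr_gt0.
  have := chernoff_sqrt_mass r0 p_gt0 erefl.
  rewrite -/u (_ : u + x - u = x); last by rewrite addrC addKr.
  apply: le_trans; apply: le_measure; rewrite ?inE//.
    rewrite -[X in measurable X]setTI.
    apply: (measurable_fun_ler (f := cst _)) => //.
    by apply: measurable_funM => //; exact: measurable_mass_recentred_mean.
  move=> w /= /sub; apply: ler_wpM2l.
  rewrite mulr_ge0// ln_ge0// ler_pdivlMr// mul1r lerDl.
  exact: ltW.
have u_eq0 : u = 0 by rewrite /u p0 sqrtr0.
have mX : measurable_fun setT (fun w => 1 * (n%:R * mass (recentred_mean w))).
  do 2 apply: measurable_funM => //.
  exact: measurable_mass_recentred_mean.
have := exponential_markov Pr (n%:R * x ^+ 2) mX.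
have := expR_mass_recentred_mean 1; rewrite p0 mul0r mulr0 expR0 => H1.
move=> /le_trans/(_ (lee_wpmul2r _ H1)); rewrite mul1e.
move=> /(_ (expR_ge0 _)); apply: le_trans; apply: le_measure; rewrite ?inE//.
  rewrite -[X in measurable X]setTI.
  exact: (measurable_fun_ler (f := cst _)).
by move=> w /= /sub; rewrite u_eq0 add0r mul1r ler_pM2l.
Qed.

Lemma sqrt_mass_lower_tail (x : R) : 0 < x ->
  (Pr [set w | Num.sqrt (mass (recentred_mean w)) < Num.sqrt (mass m) - x]%R <=
   (expR (- (n%:R * x ^+ 2)))%:E)%E.
Proof.
move=> x0; set u := Num.sqrt (mass m).
have ms : measurable [set w | Num.sqrt (mass (recentred_mean w)) < u - x].
  rewrite -[X in measurable X]setTI.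
  apply: (measurable_fun_ltr (g := cst (u - x))) => //.
  by apply: (measurableT_comp (@measurable_sqrt R)); exact: measurable_mass_recentred_mean.
have [r0|r0] := leP (u - x) 0.
  rewrite (_ : [set w | _] = set0) ?measure0 ?lee_fin ?expR_ge0//.
  apply/seteqP; split => w //= H.
  by have := lt_le_trans H r0; rewrite ltNge sqrtr_ge0.
have u_gt0 : 0 < u by rewrite (lt_trans x0)// -subr_gt0.
have p_gt0 : 0 < mass m by rewrite -sqrtr_gt0.
have := chernoff_sqrt_mass r0 p_gt0 erefl.
rewrite -/u (_ : u - x - u = - x) ?sqrrN; last by rewrite addrAC subrr sub0r.
apply: le_trans; apply: le_measure; rewrite ?inE//.
  rewrite -[X in measurable X]setTI.
  apply: (measurable_fun_ler (f := cst _)) => //.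
  by apply: measurable_funM => //; exact: measurable_mass_recentred_mean.
move=> w /= H; apply: ler_wnM2l.
  rewrite mulr_ge0_le0// ln_le0// ler_pdivrMr// mul1r gerBl.
  exact: ltW.
have [q0|q0] := leP (mass (recentred_mean w)) 0.
  by apply: le_trans q0 (sqr_ge0 _).
rewrite -[leLHS](sqr_sqrtr (ltW q0)) lerXn2r ?nnegrE ?sqrtr_ge0 ?ltW//.
Qed.

End poisson_tails.

(** * Comparison of the distances on the simplex *)

Section distances.
Context (R : realType) (k : nat).
Implicit Types (a b v m theta : k.-tuple R) (S : {set 'I_k}).

Lemma dTVC a b : dTV a b = dTV b a.
Proof. by rewrite /dTV; congr (_ * _); apply: eq_bigr => j _; rewrite distrC. Qed.

Lemma dTV_pos a b : simplex a -> simplex b ->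
  dTV a b = \sum_(j < k) Num.max 0 (tnth b j - tnth a j).
Proof.
move=> [_ a1] [_ b1]; rewrite /dTV.
rewrite (eq_bigr (fun j => (tnth a j - tnth b j) +
    2 * Num.max 0 (tnth b j - tnth a j))); last first.
  move=> j _; case: (leP 0 (tnth b j - tnth a j)) => h.
    by rewrite distrC ger0_norm//; ring.
  by rewrite distrC ltr0_norm//; ring.
by rewrite big_split/= sumrB a1 b1 subrr add0r -mulr_sumr mulKf.
Qed.

Lemma dTV_ge0 a b : 0 <= dTV a b.
Proof. by rewrite /dTV mulr_ge0 ?invr_ge0// sumr_ge0. Qed.

Lemma dTV_le1 a b : simplex a -> simplex b -> dTV a b <= 1.
Proof.
move=> sa sb; rewrite dTV_pos//; case: sb => b0 <-; apply: ler_sum => j _.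
by rewrite ge_max b0/= gerBl; case: sa.
Qed.

Lemma dTV_coordinate a b j : simplex a -> simplex b ->
  `|tnth a j - tnth b j| <= dTV a b.
Proof.
have H (c e : k.-tuple R) : simplex c -> simplex e -> tnth e j - tnth c j <= dTV c e.
  move=> sc se; rewrite dTV_pos// (bigD1 j)//= -[leLHS]addr0 lerD//.
    by rewrite le_max lexx orbT.
  by apply: sumr_ge0 => i _; rewrite le_max lexx.
move=> sa sb; rewrite ler_norml; apply/andP; split; last by rewrite dTVC H.
by rewrite lerNl opprB H.
Qed.

Lemma dL2_le_dTV a b : simplex a -> simplex b -> dL2 a b <= Num.sqrt 2 * dTV a b.
Proof.
move=> sa sb; have t0 := dTV_ge0 a b.
rewrite -[dTV a b]ger0_norm// -sqrtr_sqr -sqrtrM// /dL2 ler_wsqrtr//.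
apply: (@le_trans _ _ (\sum_(j < k) dTV a b * `|tnth a j - tnth b j|)).
  apply: ler_sum => j _; rewrite -[leLHS]ger0_norm ?sqr_ge0// normrX expr2.
  by rewrite ler_wpM2r// dTV_coordinate.
by rewrite -mulr_sumr le_eqVlt; apply/predU1P; left; rewrite /dTV; field.
Qed.

Lemma sqr_sqrt_sub_le (x y : R) : 0 <= x -> 0 <= y ->
  (Num.sqrt x - Num.sqrt y) ^+ 2 <= `|x - y|.
Proof.
move=> x0 y0; rewrite -{2}(sqr_sqrtr x0) -{2}(sqr_sqrtr y0) subr_sqr normrM.
rewrite -[leLHS]ger0_norm ?sqr_ge0// normrX expr2 ler_wpM2l//.
rewrite [leRHS]ger0_norm ?addr_ge0 ?sqrtr_ge0// ler_norml.
have := sqrtr_ge0 x; have := sqrtr_ge0 y; lra.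
Qed.

Lemma dH_le_dTV a b : simplex a -> simplex b -> dH a b <= Num.sqrt (2 * dTV a b).
Proof.
move=> [a0 _] [b0 _]; rewrite /dH /dTV mulrA mulfV// mul1r ler_wsqrtr//.
by apply: ler_sum => j _; apply: sqr_sqrt_sub_le.
Qed.

Lemma dL2_triangle a b c : dL2 a c <= dL2 a b + dL2 b c.
Proof.
apply: le_trans (l2_triangle _ _ _ _); rewrite le_eqVlt; apply/predU1P; left.
by congr Num.sqrt; apply: eq_bigr => j _; congr (_ ^+ 2); ring.
Qed.

Lemma dH_triangle a b c : dH a c <= dH a b + dH b c.
Proof.
apply: le_trans (l2_triangle _ _ _ _); rewrite le_eqVlt; apply/predU1P; left.
by congr Num.sqrt; apply: eq_bigr => j _; congr (_ ^+ 2); ring.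
Qed.

(** The total variation distance is the sum of the positive parts of the
differences, and those of [theta j - a j] vanish off [S]. *)
Lemma dTV_sparse S a theta : simplex a -> simplex theta ->
  (forall j, j \notin S -> tnth theta j = 0) ->
  dTV a theta = \sum_(j in S) Num.max 0 (tnth theta j - tnth a j).
Proof.
move=> sa st thS; rewrite dTV_pos// (bigID (mem S))/= [X in _ + X]big1 ?addr0//.
move=> j /thS ->; rewrite sub0r; apply/max_idPl.
by rewrite oppr_le0; case: sa.
Qed.

Lemma sum_pos_le_dTV S a b : simplex a -> simplex b ->
  \sum_(j in S) Num.max 0 (tnth b j - tnth a j) <= dTV a b.
Proof.
move=> sa sb; rewrite dTV_pos// [leRHS](bigID (mem S))/= lerDl.
by apply: sumr_ge0 => j _; rewrite le_max lexx.
Qed.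

Lemma dTV_sparse_le S x u m theta :
  simplex x -> simplex u -> simplex m -> simplex theta ->
  (forall j, j \notin S -> tnth theta j = 0) ->
  dTV x theta <= dTV x u + dTV m theta +
    \sum_(j in S) Num.max 0 (tnth m j - tnth u j).
Proof.
move=> sx su sm st thS; rewrite (dTV_sparse sx st thS).
apply: (@le_trans _ _ (\sum_(j in S) Num.max 0 (tnth u j - tnth x j) +
    \sum_(j in S) Num.max 0 (tnth theta j - tnth m j) +
    \sum_(j in S) Num.max 0 (tnth m j - tnth u j))); last first.
  by rewrite lerD2r lerD// sum_pos_le_dTV.
rewrite -!big_split/=; apply: ler_sum => j _.
have p (y : R) : 0 <= Num.max 0 y /\ y <= Num.max 0 y.
  by rewrite !le_max !lexx orbT.
have [p1 q1] := p (tnth u j - tnth x j).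
have [p2 q2] := p (tnth theta j - tnth m j).
have [p3 q3] := p (tnth m j - tnth u j).
by rewrite ge_max; apply/andP; split; lra.
Qed.

(** Off the support [S] of [theta] the squared distance is the mass of [u],
so the whole complement of [S] enters as one coordinate. *)
Lemma dH_sparse_le S u m theta (x c : R) :
  simplex u -> simplex m -> simplex theta ->
  (forall j, j \notin S -> tnth theta j = 0) -> 0 <= x -> 0 <= c ->
  (forall j, j \in S -> `|Num.sqrt (tnth u j) - Num.sqrt (tnth m j)| <= x) ->
  Num.sqrt (\sum_(j in ~: S) tnth u j) <=
    Num.sqrt (\sum_(j in ~: S) tnth m j) + c ->
  dH u theta <= Num.sqrt #|S|%:R * x + c + Num.sqrt (2 * dTV m theta).
Proof.
move=> su sm st thS x0 c0 uS uSc.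
have off (v : k.-tuple R) : simplex v ->
    \sum_(j < k) (Num.sqrt (tnth v j) - Num.sqrt (tnth theta j)) ^+ 2 =
    \sum_(j in S) (Num.sqrt (tnth v j) - Num.sqrt (tnth theta j)) ^+ 2 +
    \sum_(j in ~: S) tnth v j.
  move=> [v0 _]; rewrite (bigID (mem S))/=; congr (_ + _).
  rewrite [RHS](eq_bigl (fun j => j \notin S)); last by move=> j; rewrite inE.
  by apply: eq_bigr => j /thS ->; rewrite sqrtr0 subr0 sqr_sqrtr.
have sum0 (v : k.-tuple R) : simplex v -> 0 <= \sum_(j in ~: S) tnth v j.
  by move=> [v0 _]; exact: sumr_ge0.
have mD := dH_le_dTV sm st.
set D := Num.sqrt (2 * dTV m theta) in mD *.
set A := Num.sqrt #|S|%:R * x.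
pose d1 := Num.sqrt (\sum_(j in S) (Num.sqrt (tnth m j) - Num.sqrt (tnth theta j)) ^+ 2).
pose d2 := Num.sqrt (\sum_(j in ~: S) tnth m j).
pose e1 := Num.sqrt (\sum_(j in S) (Num.sqrt (tnth u j) - Num.sqrt (tnth theta j)) ^+ 2).
pose e2 := Num.sqrt (\sum_(j in ~: S) tnth u j).
have sq0 (f : 'I_k -> R) : 0 <= \sum_(j in S) f j ^+ 2.
  by apply: sumr_ge0 => j _; exact: sqr_ge0.
have d12 : d1 ^+ 2 + d2 ^+ 2 <= D ^+ 2.
  have -> : d1 ^+ 2 = \sum_(j in S) (Num.sqrt (tnth m j) - Num.sqrt (tnth theta j)) ^+ 2.
    by rewrite sqr_sqrtr.
  have -> : d2 ^+ 2 = \sum_(j in ~: S) tnth m j by rewrite sqr_sqrtr// sum0.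
  rewrite -off//.
  have <- : dH m theta ^+ 2 =
      \sum_(j < k) (Num.sqrt (tnth m j) - Num.sqrt (tnth theta j)) ^+ 2.
    by rewrite sqr_sqrtr// sumr_ge0// => j _; exact: sqr_ge0.
  by rewrite lerXn2r ?nnegrE ?sqrtr_ge0.
have e1d1 : e1 <= A + d1.
  apply: (@le_trans _ _ (Num.sqrt (\sum_(j in S) ((Num.sqrt (tnth u j) - Num.sqrt (tnth m j))
     + (Num.sqrt (tnth m j) - Num.sqrt (tnth theta j))) ^+ 2))).
    rewrite le_eqVlt; apply/predU1P; left.
    by congr Num.sqrt; apply: eq_bigr => j _; congr (_ ^+ 2); ring.
  apply: le_trans (l2_triangle _ _ _ _) _; rewrite lerD2r.
  rewrite /A -[x in leRHS]ger0_norm// -sqrtr_sqr -sqrtrM// ler_wsqrtr//.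
  rewrite mulr_natl -sumr_const; apply: ler_sum => j jS.
  rewrite -[leLHS]ger0_norm ?sqr_ge0// normrX.
  by rewrite lerXn2r ?nnegrE// uS.
have A0 : 0 <= A by rewrite mulr_ge0 ?sqrtr_ge0.
have D0 : 0 <= D by exact: sqrtr_ge0.
have [d10 d20] : 0 <= d1 /\ 0 <= d2 by split; exact: sqrtr_ge0.
have [e10 e20] : 0 <= e1 /\ 0 <= e2 by split; exact: sqrtr_ge0.
have d1D : d1 <= D.
  by rewrite -(@ler_pXn2r _ 2) ?nnegrE//; apply: le_trans d12; rewrite lerDl sqr_ge0.
have d2D : d2 <= D.
  by rewrite -(@ler_pXn2r _ 2) ?nnegrE//; apply: le_trans d12; rewrite lerDr sqr_ge0.
rewrite /dH off// -[leRHS]ger0_norm ?addr_ge0// -sqrtr_sqr ler_wsqrtr//.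
rewrite -[X in X + _](sqr_sqrtr (sq0 _)) -[X in _ + X](sqr_sqrtr (sum0 _ su)).
rewrite -/e1 -/e2.
apply: (@le_trans _ _ ((A + d1) ^+ 2 + (c + d2) ^+ 2)).
  apply: lerD; rewrite lerXn2r ?nnegrE ?addr_ge0//.
  by rewrite addrC.
have := ler_wpM2l A0 d1D; have := ler_wpM2l c0 d2D; have := mulr_ge0 A0 c0.
clearbody d1 d2 A D e1 e2.
nra.
Qed.

Definition mean_of n (z : 'I_n -> k.-tuple R) : k.-tuple R :=
  [tuple n%:R^-1 * \sum_(i < n) tnth (z i) j | j < k].

Lemma mean_of_simplex n (z : 'I_n -> k.-tuple R) : (0 < n)%N ->
  (forall i, simplex (z i)) -> simplex (mean_of z).
Proof.
move=> n0 sz; split=> [j|].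
  rewrite tnth_mktuple mulr_ge0 ?invr_ge0// sumr_ge0// => i _.
  by case: (sz i).
under eq_bigr do rewrite tnth_mktuple.
rewrite -mulr_sumr exchange_big/= (eq_bigr (fun=> 1)); last by move=> i _; case: (sz i).
by rewrite sumr_const card_ord mulVf// pnatr_eq0 -lt0n.
Qed.

Lemma dTV_mean_of n (z z' : 'I_n -> k.-tuple R) (O : {set 'I_n}) :
  (forall i, simplex (z i)) -> (forall i, simplex (z' i)) ->
  (forall i, i \notin O -> z i = z' i) ->
  dTV (mean_of z) (mean_of z') <= n%:R^-1 * #|O|%:R.
Proof.
move=> sz sz' zO.
apply: (@le_trans _ _ (n%:R^-1 * \sum_(i < n) dTV (z i) (z' i))).
  rewrite /dTV -mulr_sumr [leRHS]mulrCA ler_wpM2l ?invr_ge0//.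
  rewrite exchange_big/= mulr_sumr.
  apply: ler_sum => j _; rewrite !tnth_mktuple -mulrBr -sumrB normrM.
  by rewrite ger0_norm ?invr_ge0// ler_wpM2l ?invr_ge0// ler_norm_sum.
rewrite ler_wpM2l ?invr_ge0// (bigID (mem O))/= [X in _ + X]big1 ?addr0.
  rewrite -sum1_card natr_sum; apply: ler_sum => i _; exact: dTV_le1.
by move=> i /zO ->; rewrite /dTV big1 ?mulr0// => j _; rewrite subrr normr0.
Qed.

End distances.

(** * The clean draws inside a contaminated sample *)

Lemma has_mean_Rintegral (R : realType) (k : nat) (mu : probability (k.-tuple R) R) :
  on_simplex mu ->
  has_mean mu [tuple \int[mu]_(y in @simplex R k) tnth y j | j < k].
Proof.
move=> muD j; rewrite unlock tnth_mktuple /= (integral_coordinate_carrier muD).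
rewrite /Rintegral fineK//; apply: integrable_fin_num => //.
  exact: measurable_simplex.
exact: integrable_coordinate.
Qed.

Lemma dTV_self (R : realType) (k : nat) (a : k.-tuple R) : dTV a a = 0.
Proof. by rewrite /dTV big1 ?mulr0// => j _; rewrite subrr normr0. Qed.

(** The mean of the mixture is at least [(1 - eps) * theta] in every coordinate, so
at most the fraction [eps] of the mass of [theta] is missing. *)
Lemma mixture_mean (R : realType) (k : nat) (eps : R)
    (P Q mu : probability (k.-tuple R) R) (theta m : k.-tuple R) :
  0 <= eps <= 1 -> on_simplex P -> on_simplex mu ->
  has_mean P theta -> has_mean mu m ->
  (forall A, measurable A -> mu A = ((1 - eps)%:E * P A + eps%:E * Q A)%E) ->
  dTV m theta <= eps.
Proof.
move=> /andP[e0 e1] PD muD Pm mum muE.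
have mD := @measurable_simplex R k.
have e1' : 0 <= 1 - eps by rewrite subr_ge0.
have mth : simplex theta := mean_simplex PD Pm.
have mm : simplex m := mean_simplex muD mum.
rewrite dTV_pos//.
have [th0 th1] := mth.
rewrite -[leRHS]mulr1 -[in leRHS]th1 mulr_sumr; apply: ler_sum => j _.
rewrite ge_max mulr_ge0//= lerBlDr -lerBlDl -[X in X - _]mul1r -mulrBl.
rewrite -lee_fin.
have mP : (\int[P]_(y in @simplex R k) (tnth y j)%:E = (tnth theta j)%:E)%E.
  by have := Pm j; rewrite unlock (integral_coordinate_carrier PD).
have mM : (\int[mu]_(y in @simplex R k) (tnth y j)%:E = (tnth m j)%:E)%E.
  by have := mum j; rewrite unlock (integral_coordinate_carrier muD).
have f0 (y : k.-tuple R) : simplex y -> (0 <= (tnth y j)%:E)%E.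
  by move=> [y0 _]; rewrite lee_fin.
have mf : measurable_fun (@simplex R k) (fun y : k.-tuple R => (tnth y j)%:E).
  apply: measurable_funS (measurableT) _ _ => //.
  by apply/measurable_EFinP; exact: measurable_tnth.
rewrite -mM (eq_measure_integral (measure_add
  (mscale (NngNum e1') P) (mscale (NngNum e0) Q))); last first.
  by move=> A mA _; apply: etrans (muE A mA) _; exact/esym/measure_addE.
rewrite ge0_integral_measure_add// !ge0_integral_mscale//=.
rewrite mP EFinM leeDl// mule_ge0 ?lee_fin//.
exact: integral_ge0.
Qed.

(** In each model some of the draws are independent with a common law [mu] on
the simplex, and except at [n * e] indices at most the sample consists of these
draws and of the mean [m] of [mu]. Either [m] is [theta] and [e] is the budget [eps], or
(Huber's mixture) [e] is zero and the bias sits in [m]. *)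
Lemma contaminated_core (d : measure_display) (Omega : measurableType d)
    (R : realType) (k n : nat) (Pr : probability Omega R)
    (X : 'I_n -> {RV Pr >-> k.-tuple R}) (eps : R)
    (P : probability (k.-tuple R) R) (theta : k.-tuple R) (mo : contamination) :
  (0 < n)%N -> 0 <= eps <= 1 -> on_simplex P -> has_mean P theta ->
  (forall i w, simplex (X i w)) -> contaminated mo X eps P theta ->
  exists (I : {set 'I_n}) (Z : 'I_n -> {RV Pr >-> k.-tuple R})
    (mu : probability (k.-tuple R) R) (m : k.-tuple R) (e : R),
  [/\ on_simplex mu, has_mean mu m, mutually_independent I Z,
      forall i, i \in I -> has_law (Z i) mu &
  [/\ 0 <= e, e + dTV m theta <= eps, e = 0 \/ m = theta &
      forall w, exists2 O : {set 'I_n}, #|O|%:R <= n%:R * e &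
        forall i, i \notin O -> X i w = if i \in I then Z i w else m]].
Proof.
move=> n0 e01 PD Pm sX.
have [e0 e1] := andP e01.
(* Deterministic outliers: the draws off the outlier set are the clean ones,
   whatever the law of the others. *)
have inliers (O : {set 'I_n}) : #|O|%:R <= n%:R * eps ->
    mutually_independent (~: O)%SET X -> (forall i, i \notin O -> has_law (X i) P) ->
    exists (I : {set 'I_n}) (Z : 'I_n -> {RV Pr >-> k.-tuple R})
      (mu : probability (k.-tuple R) R) (m : k.-tuple R) (e : R),
    [/\ on_simplex mu, has_mean mu m, mutually_independent I Z,
        forall i, i \in I -> has_law (Z i) mu &
    [/\ 0 <= e, e + dTV m theta <= eps, e = 0 \/ m = theta &
        forall w, exists2 O : {set 'I_n}, #|O|%:R <= n%:R * e &
          forall i, i \notin O -> X i w = if i \in I then Z i w else m]].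
  move=> On indX lawX.
  exists (~: O)%SET, X, P, theta, eps; split=> //.
    by move=> i; rewrite inE; exact: lawX.
  split=> //; [by rewrite dTV_self addr0|by right|move=> w].
  by exists O => // i iO; rewrite inE iO.
case: mo => /=.
- move=> [Q [QD [indX lawX]]].
  pose i0 := Ordinal n0.
  pose mu : probability (k.-tuple R) R := distribution Pr (X i0).
  have muE A : measurable A -> mu A = ((1 - eps)%:E * P A + eps%:E * Q A)%E.
    by move=> mA; apply: lawX => //; rewrite inE.
  have muD : on_simplex mu.
    rewrite /on_simplex muE; last exact: measurable_simplex.
    rewrite (PD : P _ = 1%E) (QD : Q _ = 1%E) !mule1 -EFinD subrK.
    by [].
  have mum := has_mean_Rintegral muD.
  have me := mixture_mean e01 PD muD Pm mum muE.
  exists [set: 'I_n]%SET, X, mu, [tuple \int[mu]_(y in @simplex R k) tnth y j | j < k], 0.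
  split=> //.
    by move=> i _ A mA; rewrite lawX// muE.
  split=> //; [by rewrite add0r|by left|move=> w].
  by exists finset.set0; [rewrite cards0 mulr0|move=> i _; rewrite inE].
- move=> [J [Q [On _ [indX lawX] _ _]]]; apply: (inliers J) => // i iJ.
  by apply: lawX; rewrite inE.
- move=> [J [On [indX lawX] _]]; apply: (inliers J) => // i iJ.
  by apply: lawX; rewrite inE.
- move=> [J [_ [_ [On indX lawX _]]]]; apply: (inliers J) => //.
  by move=> K _; apply: indX; exact: finset.subsetT.
- move=> [Y [Oh [r [[indY lawY] _ r_le Ohr XY]]]].
  exists [set: 'I_n]%SET, Y, P, theta, eps; split=> //.
  split=> //; [by rewrite dTV_self addr0|by right|move=> w].
  by exists (Oh w); [rewrite Ohr|move=> i iO; rewrite inE XY].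
Qed.

Lemma union_bound dO (Omega : measurableType dO) (R : realType)
    (Pr : probability Omega R) (J : finType) (S : {set J}) (F : J -> set Omega) (c : R) :
  (forall j, j \in S -> measurable (F j)) ->
  (forall j, j \in S -> Pr (F j) <= c%:E)%E ->
  (Pr (\big[setU/set0]_(j in S) F j) <= (#|S|%:R * c)%:E)%E.
Proof.
move=> mF Fc.
rewrite -(big_enum)/= cardE.
have : {subset enum S <= S} by move=> j; rewrite mem_enum.
elim: (enum S) => [|j r IH] rS; first by rewrite big_nil measure0 mul0r.
have jS : j \in S by apply: rS; rewrite mem_head.
have rS' : {subset r <= S} by move=> i ir; apply: rS; rewrite in_cons ir orbT.
rewrite big_cons.
have mr : measurable (\big[setU/set0]_(i <- r) F i).
  by rewrite big_seq; apply: bigsetU_measurable => i ir; apply: mF; exact: rS'.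
apply: (le_trans (measureU2 Pr (mF _ jS) mr)).
rewrite /= -addn1 natrD mulrDl mul1r [(_ + c)%R]addrC EFinD; apply: leeD; first exact: Fc.
exact: IH.
Qed.

Section recentred_mean.
Context (R : realType) (k n : nat).
Variables (mu : probability (k.-tuple R) R) (m : k.-tuple R).
Hypotheses (muD : on_simplex mu) (n0 : (0 < n)%N).
Context dO (Omega : measurableType dO) (Pr : probability Omega R).
Variables (I : {set 'I_n}) (Z : 'I_n -> {RV Pr >-> k.-tuple R}).
Hypothesis lawZ : forall i, i \in I -> has_law (Z i) mu.

Lemma recentred_meanE w :
  recentred_mean m I Z w = mean_of (fun i => if i \in I then Z i w else m).
Proof.
apply: eq_from_tnth => j; rewrite !tnth_mktuple tnth_deviation.
rewrite (_ : \sum_(i < n) _ = \sum_(i < n) tnth m j +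
    \sum_(i in I) (tnth (Z i w) j - tnth m j)); last first.
  rewrite [X in _ + X]big_mkcond/= -big_split/=; apply: eq_bigr => i _.
  by case: ifP => _; ring.
rewrite sumr_const card_ord mulrDr -[tnth m j *+ n]mulr_natl mulrA mulVf ?mul1r//.
by rewrite pnatr_eq0 -lt0n.
Qed.

Definition outside_simplex : set Omega :=
  \big[setU/set0]_(i in I) (Z i @^-1` (~` @simplex R k)).

Lemma measurable_outside_simplex : measurable outside_simplex.
Proof.
by apply: bigsetU_measurable => i _; apply: measurable_funPTI;
  apply: measurableC; exact: measurable_simplex.
Qed.

Lemma outside_simplex_null : Pr outside_simplex = 0%E.
Proof.
have mDC : measurable (~` @simplex R k).
  by apply: measurableC; exact: measurable_simplex.
apply/eqP; rewrite eq_le measure_ge0 andbT.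
have := @union_bound _ _ _ Pr _ I (fun i => Z i @^-1` (~` @simplex R k)) 0.
rewrite mulr0; apply=> i iI; first exact: measurable_funPTI.
have -> : Pr (Z i @^-1` (~` @simplex R k)) = mu (~` @simplex R k) by exact: lawZ.
rewrite probability_setC; last exact: measurable_simplex.
by rewrite (muD : mu _ = 1%E) subee.
Qed.

Lemma simplex_draws w : ~ outside_simplex w -> forall i, i \in I -> simplex (Z i w).
Proof.
move=> nw i iI; apply: contrapT => nZ; apply: nw.
by rewrite /outside_simplex (bigD1 i)//=; left.
Qed.

End recentred_mean.

(** * Confidence regions *)

Section coverage.
Context (R : realType) (k n : nat).
Implicit Types theta : k.-tuple R.

Lemma sample_mean_tuple (z : 'I_n -> k.-tuple R) :
  sample_mean [tuple z i | i < n] = mean_of z.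
Proof.
apply: eq_from_tnth => j; rewrite !tnth_mktuple; congr (_ * _).
by apply: eq_bigr => i _; rewrite tnth_mktuple.
Qed.

Lemma measurable_sample_mean :
  measurable_fun setT (fun x : n.-tuple (k.-tuple R) => sample_mean x).
Proof.
apply/measurable_fun_tnthP => j.
rewrite (_ : _ \o _ =
    fun x : n.-tuple (k.-tuple R) => n%:R^-1 * \sum_(i < n) tnth (tnth x i) j); last first.
  by apply/funext => x; rewrite /= tnth_mktuple.
apply: measurable_funM => //; apply: measurable_sum => i.
by apply: (measurableT_comp (measurable_tnth j)); exact: measurable_tnth.
Qed.

Lemma measurable_dL2 theta : measurable_fun setT (fun c : k.-tuple R => dL2 c theta).
Proof.
apply: (measurableT_comp (@measurable_sqrt R)); apply: measurable_sum => j.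
by apply: measurable_funX; apply: measurable_funB => //; exact: measurable_tnth.
Qed.

Lemma measurable_dTV theta : measurable_fun setT (fun c : k.-tuple R => dTV c theta).
Proof.
apply: measurable_funM => //; apply: measurable_sum => j.
apply: measurableT_comp => //.
by apply: measurable_funB => //; exact: measurable_tnth.
Qed.

Lemma measurable_dH theta : measurable_fun setT (fun c : k.-tuple R => dH c theta).
Proof.
apply: (measurableT_comp (@measurable_sqrt R)); apply: measurable_sum => j.
apply: measurable_funX; apply: measurable_funB => //.
by apply: (measurableT_comp (@measurable_sqrt R)); exact: measurable_tnth.
Qed.

Variables (mu : probability (n.-tuple (k.-tuple R)) R).
Context dO (Omega : measurableType dO) (Pr : probability Omega R).
Variable X : 'I_n -> {RV Pr >-> k.-tuple R}.
Hypothesis muX : forall A, measurable A -> mu A = Pr [set w | A [tuple X i w | i < n]].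

Lemma coverage (dist : k.-tuple R -> k.-tuple R -> R) theta (r delta : R)
    (N B : set Omega) :
  simplex theta -> measurable_fun setT (fun c => dist c theta) ->
  measurable N -> Pr N = 0%E -> measurable B -> (Pr B <= delta%:E)%E ->
  (forall w, ~ N w -> ~ B w -> dist (mean_of (X ^~ w)) theta <= r) ->
  ((1 - delta)%:E <= mu [set x | region dist (sample_mean x) r theta])%E.
Proof.
move=> sth md mN N0 mB Bd good.
set A := [set x | _].
have AE : A = [set x | dist (sample_mean x) theta <= r].
  by apply/seteqP; split => x /=; [case|split].
have mA : measurable A.
  rewrite AE -[X in measurable X]setTI.
  apply: (measurable_fun_ler (g := cst r)) => //.
  by apply: (measurableT_comp md); exact: measurable_sample_mean.
rewrite muX//.
set E := [set w | _].
have mE : measurable E.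
  have mt : measurable_fun setT (fun w => [tuple X i w | i < n]).
    apply/measurable_fun_tnthP => i.
    rewrite (_ : _ \o _ = X i)//.
    by apply/funext => w; rewrite /= tnth_mktuple.
  by rewrite -[E]setTI; exact: mt.
have sub : ~` (N `|` B) `<=` E.
  move=> w /= NB; rewrite /E /= AE /= sample_mean_tuple.
  by apply: good => H; apply: NB; [left|right].
have mNB : measurable (N `|` B) by exact: measurableU.
have le1 : (Pr (N `|` B) <= delta%:E)%E.
  have sumNB : (Pr N + Pr B <= delta%:E)%E by rewrite N0 add0e.
  exact: le_trans (measureU2 Pr mN mB) sumNB.
apply: (@le_trans _ _ (Pr (~` (N `|` B)))); last first.
  by apply: le_measure; rewrite ?inE//; exact: measurableC.
rewrite probability_setC// EFinB.
by apply: leeB.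
Qed.

End coverage.

Section sqrt_deviations.
Context (R : realType) (k n : nat).
Variables (mu : probability (k.-tuple R) R) (m : k.-tuple R).
Hypotheses (muD : on_simplex mu) (mum : has_mean mu m) (n0 : (0 < n)%N).
Context dO (Omega : measurableType dO) (Pr : probability Omega R).
Variables (I : {set 'I_n}) (Z : 'I_n -> {RV Pr >-> k.-tuple R}).
Hypothesis indZ : mutually_independent I Z.
Hypothesis lawZ : forall i, i \in I -> has_law (Z i) mu.

Let nR : 0 < n%:R :> R. Proof. by rewrite ltr0n. Qed.

Lemma expR_sqrt_level (c : R) : 1 < c ->
  0 < Num.sqrt (n%:R^-1 * ln c) /\
  expR (- (n%:R * Num.sqrt (n%:R^-1 * ln c) ^+ 2)) = c^-1.
Proof.
move=> c1; have L0 := ln_gt0 c1.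
have q0 : 0 < n%:R^-1 * ln c by rewrite mulr_gt0// invr_gt0.
split; first by rewrite sqrtr_gt0.
have c0 : 0 < c := lt_trans ltr01 c1.
rewrite sqr_sqrtr ?(ltW q0)// mulrA mulfV ?mul1r ?gt_eqF//.
by rewrite -lnV// lnK// posrE invr_gt0.
Qed.

(** Half of the level is shared by the two tails of the coordinates in [S], the
other half is spent on the mass of the complement of [S]. *)
Lemma sqrt_deviations (S : {set 'I_k}) (s : nat) (delta : R) :
  0 < delta < 1 -> (0 < s)%N -> (#|S| <= s)%N ->
  exists B : set Omega, [/\ measurable B, (Pr B <= delta%:E)%E &
    forall w, ~ B w ->
      (forall j, j \in S -> `|Num.sqrt (tnth (recentred_mean m I Z w) j) -
          Num.sqrt (tnth m j)| <= Num.sqrt (n%:R^-1 * ln (4 * s%:R / delta))) /\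
      Num.sqrt (\sum_(j in ~: S) tnth (recentred_mean m I Z w) j) <=
      Num.sqrt (\sum_(j in ~: S) tnth m j) + Num.sqrt (n%:R^-1 * ln (2 / delta))].
Proof.
move=> /andP[d0 d1] s0 Ss.
have sR : 1 <= s%:R :> R by rewrite ler1n.
have c1 : 1 < 4 * s%:R / delta by rewrite ltr_pdivlMr//; lra.
have c2 : 1 < 2 / delta by rewrite ltr_pdivlMr//; lra.
have [x0 ex] := expR_sqrt_level c1.
have [y0 ey] := expR_sqrt_level c2.
set x := Num.sqrt (n%:R^-1 * ln (4 * s%:R / delta)) in x0 ex *.
set y := Num.sqrt (n%:R^-1 * ln (2 / delta)) in y0 ey *.
pose U w := recentred_mean m I Z w.
pose up (A : {set 'I_k}) c := [set w | Num.sqrt (mass A m) + c < Num.sqrt (mass A (U w))].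
pose low (A : {set 'I_k}) c := [set w | Num.sqrt (mass A (U w)) < Num.sqrt (mass A m) - c].
have msq A : measurable_fun setT (fun w => Num.sqrt (mass A (U w))).
  apply: (measurableT_comp (@measurable_sqrt R)).
  exact: measurable_mass_recentred_mean.
have mup A c : measurable (up A c).
  rewrite -[up A c]setTI.
  exact: (measurable_fun_ltr (f := cst (Num.sqrt (mass A m) + c))).
have mlow A c : measurable (low A c).
  rewrite -[low A c]setTI.
  exact: (measurable_fun_ltr (g := cst (Num.sqrt (mass A m) - c))).
pose F j := up [set j]%SET x `|` low [set j]%SET x.
have mF j : measurable (F j) by exact: measurableU.
have PrF j : (Pr (F j) <= (delta / (2 * s%:R))%:E)%E.
  have PF : (Pr (up [set j]%SET x) + Pr (low [set j]%SET x) <=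
      (delta / (2 * s%:R))%:E)%E.
    rewrite (_ : delta / (2 * s%:R) = (4 * s%:R / delta)^-1 + (4 * s%:R / delta)^-1).
      rewrite EFinD -ex; apply: leeD.
        exact: (sqrt_mass_upper_tail muD mum n0 indZ lawZ).
      exact: (sqrt_mass_lower_tail muD mum n0 indZ lawZ).
    by field; rewrite !gt_eqF// (lt_le_trans ltr01).
  exact: le_trans (measureU2 Pr (mup _ _) (mlow _ _)) PF.
pose B1 := \big[setU/set0]_(j in S) F j.
have mB1 : measurable B1 by apply: bigsetU_measurable => j _; exact: mF.
have PrB1 : (Pr B1 <= (delta / 2)%:E)%E.
  apply: le_trans (union_bound (fun j _ => mF j) (fun j _ => PrF j)) _.
  rewrite lee_fin (_ : delta / 2 = s%:R * (delta / (2 * s%:R))); last first.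
    by field; rewrite gt_eqF// (lt_le_trans ltr01).
  by rewrite ler_wpM2r ?ler_nat// divr_ge0// ltW.
exists (B1 `|` up (~: S)%SET y); split.
- exact: measurableU.
- have PrU : (Pr B1 + Pr (up (~: S)%SET y) <= delta%:E)%E.
    rewrite [delta]splitr EFinD; apply: leeD => //.
    rewrite -[delta / 2]invf_div -ey; exact: (sqrt_mass_upper_tail muD mum n0 indZ lawZ).
  exact: le_trans (measureU2 Pr mB1 (mup _ _)) PrU.
move=> w nB; split; last first.
  by rewrite leNgt; apply/negP => H; apply: nB; right.
move=> j jS.
have nF : ~ F j w by move=> H; apply: nB; left; rewrite /B1 (bigD1 j)//=; left.
have m1 (v : k.-tuple R) : mass [set j]%SET v = tnth v j by rewrite /mass big_set1.
rewrite ler_norml; apply/andP; split.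
  rewrite lerBrDl leNgt; apply/negP => H; apply: nF; right.
  by rewrite /low /= !m1.
rewrite lerBlDl leNgt; apply/negP => H; apply: nF; left.
by rewrite /up /= !m1.
Qed.

End sqrt_deviations.

(** The level [delta / (4 s)] of one tail costs [ln (4 s / delta)], at most twice
[ln (2 s / delta)] because [4 s / delta <= (2 s / delta)^2]; and [2 <= 3.2^2]. *)
Lemma sqrt_sparse_term (R : realType) (n s S : nat) (delta : R) :
  (0 < n)%N -> (0 < s)%N -> (S <= s)%N -> 0 < delta < 1 ->
  Num.sqrt S%:R * Num.sqrt (n%:R^-1 * ln (4 * s%:R / delta)) <=
  32 / 10 * Num.sqrt (s%:R / n%:R * ln (2 * s%:R / delta)).
Proof.
move=> n0 s0 Ss /andP[d0 d1].
have nR : 0 < n%:R :> R by rewrite ltr0n.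
have sR : 1 <= s%:R :> R by rewrite ler1n.
have c2 : 1 < 2 * s%:R / delta by rewrite ltr_pdivlMr//; lra.
have c4 : 1 < 4 * s%:R / delta by rewrite ltr_pdivlMr//; lra.
have L2 := ln_gt0 c2; have L4 := ln_gt0 c4.
have L42 : ln (4 * s%:R / delta) <= 2 * ln (2 * s%:R / delta).
  rewrite [leRHS](_ : _ = ln ((2 * s%:R / delta) ^+ 2)); last first.
    by rewrite lnXn ?(lt_trans ltr01)// mulr2n; ring.
  rewrite ler_ln ?posrE ?exprn_gt0 ?(lt_trans ltr01)//.
  rewrite -subr_ge0 (_ : _ - _ = 4 * s%:R * (s%:R - delta) / delta ^+ 2); last first.
    by field; rewrite gt_eqF.
  by rewrite divr_ge0 ?sqr_ge0// mulr_ge0//; lra.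
rewrite -sqrtrM// -[32 / 10]ger0_norm ?divr_ge0// -sqrtr_sqr -sqrtrM ?sqr_ge0//.
rewrite ler_wsqrtr//.
apply: (@le_trans _ _ (s%:R * (n%:R^-1 * (2 * ln (2 * s%:R / delta))))).
  apply: ler_pM => //; first by rewrite mulr_ge0 ?invr_ge0// ltW.
    by rewrite ler_nat.
  by rewrite ler_wpM2l ?invr_ge0.
rewrite (_ : s%:R * _ = 2 * (s%:R / n%:R * ln (2 * s%:R / delta))); last by ring.
rewrite ler_wpM2r//; last by lra.
by rewrite mulr_ge0 ?divr_ge0// ltW.
Qed.

Theorem theorem3 (R : realType) (k s n : nat) (eps delta : R)
    (theta : k.-tuple R) (m : contamination)
    (mu : probability (n.-tuple (k.-tuple R)) R)
    (hk : (0 < k)%N) (hs : (0 < s)%N) (hn : (0 < n)%N)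
    (heps : 0 <= eps <= 1) (hdelta : 0 < delta < 1)
    (htheta : sparse_simplex s theta) (hmu : model m eps theta mu) :
  [/\ ((1 - delta)%:E <= mu [set x |
         region (@dL2 R k) (sample_mean x)
           (Num.sqrt (1 / n%:R) + Num.sqrt 2 * eps
            + Num.sqrt (ln (1 / delta) / n%:R)) theta])%E,
      ((1 - delta)%:E <= mu [set x |
         region (@dTV R k) (sample_mean x)
           (Num.sqrt (s%:R / n%:R) + 2 * eps
            + Num.sqrt (2 * ln (1 / delta) / n%:R)) theta])%E
    & ((1 - delta)%:E <= mu [set x |
         region (@dH R k) (sample_mean x)
           (32 / 10 * Num.sqrt (s%:R / n%:R * ln (2 * s%:R / delta))
            + Num.sqrt (2 * eps)
            + Num.sqrt (1 / n%:R * ln (2 / delta))) theta])%E].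
Proof.
have [sth Sth] := htheta.
have [dT [T [Pr [X [P [PD Pm sX cX muX]]]]]] := hmu.
have [I [Z [nu [q [e [nuD num indZ lawZ [e0 eb e_or_q core]]]]]]] :=
  contaminated_core hn heps PD Pm sX cX.
have nR : 0 < n%:R :> R by rewrite ltr0n.
have L0 : 0 <= ln (1 / delta).
  by case/andP: hdelta => d0 d1; apply: ln_ge0; rewrite div1r invf_ge1// ltW.
set S := [set j : 'I_k | (tnth theta j != 0)%R]%SET in Sth.
have thS j : j \notin S -> tnth theta j = 0 by rewrite inE negbK => /eqP.
have sq : simplex q := mean_simplex nuD num.
have mN := measurable_outside_simplex I Z.
have N0 := outside_simplex_null nuD lawZ.
have mD := measurable_deviation q I Z.
pose u w := recentred_mean q I Z w.
(* The deterministic part: outside a null set, contamination and bias together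
   cost at most [eps] in total variation. *)
have good w : ~ outside_simplex I Z w ->
    [/\ simplex (mean_of (X ^~ w)), simplex (u w) & dTV (mean_of (X ^~ w)) (u w) <= e].
  move=> /simplex_draws sZ.
  have sz i : simplex (if i \in I then Z i w else q) by case: ifP => // /sZ.
  have [C Cn XZ] := core w.
  rewrite /u recentred_meanE//; split; [exact: mean_of_simplex..|].
  apply: le_trans (dTV_mean_of (fun i => sX i w) sz XZ) _.
  by rewrite ler_pdivrMl.
have uq w j : tnth (u w) j - tnth q j = n%:R^-1 * tnth (deviation q I Z w) j.
  by rewrite /u tnth_mktuple addrC addKr.
have dq0 := dTV_ge0 q theta.
split.
- have PB := deviation_l2norm nuD num hn indZ lawZ hdelta.
  apply: (coverage muX sth (measurable_dL2 theta) mN N0 _ PB) => [|w /good[sx su xu] nB].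
    rewrite -[X in measurable X]setTI.
    apply: (measurable_fun_ltr (f := cst _)) => //.
    apply: (measurableT_comp _ mD).
    by case: (l2norm_bounded_differences q).
  apply: le_trans (dL2_triangle _ (u w) _) _.
  apply: le_trans (lerD (lexx _) (dL2_triangle _ q _)) _.
  have H1 := dL2_le_dTV sx su.
  have H2 := dL2_le_dTV sq sth.
  have H3 : dL2 (u w) q <= Num.sqrt (1 / n%:R) + Num.sqrt (ln (1 / delta) / n%:R).
    have -> : dL2 (u w) q = n%:R^-1 * l2norm (deviation q I Z w).
      rewrite -[n%:R^-1]ger0_norm ?invr_ge0// -sqrtr_sqr -sqrtrM ?sqr_ge0//.
      congr Num.sqrt; rewrite mulr_sumr; apply: eq_bigr => j _.
      by rewrite uq exprMn.
    rewrite (_ : 1 / n%:R = n%:R^-1 ^+ 2 * n%:R); last by field; rewrite gt_eqF.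
    rewrite (_ : ln _ / n%:R = n%:R^-1 ^+ 2 * (n%:R * ln (1 / delta))); last first.
      by field; rewrite gt_eqF.
    rewrite !(sqrtrM _ (sqr_ge0 _)) sqrtr_sqr ger0_norm ?invr_ge0// -mulrDr.
    by rewrite ler_wpM2l ?invr_ge0// leNgt; apply/negP.
  have H4 : Num.sqrt 2 * dTV (mean_of (X ^~ w)) (u w) + Num.sqrt 2 * dTV q theta <=
      Num.sqrt 2 * eps.
    by rewrite -mulrDr ler_wpM2l ?sqrtr_ge0//; lra.
  lra.
- have PB := deviation_deficit nuD num hn indZ lawZ hdelta hs Sth.
  apply: (coverage muX sth (measurable_dTV theta) mN N0 _ PB) => [|w /good[sx su xu] nB].
    rewrite -[X in measurable X]setTI.
    apply: (measurable_fun_ltr (f := cst _)) => //.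
    apply: (measurableT_comp _ mD).
    by case: (deficit_bounded_differences q S).
  apply: le_trans (dTV_sparse_le sx su sq sth thS) _.
  have -> : \sum_(j in S) Num.max 0 (tnth q j - tnth (u w) j) =
      n%:R^-1 * deficit S (deviation q I Z w).
    rewrite /deficit mulr_sumr; apply: eq_bigr => j _.
    by rewrite maxr_pMr ?invr_ge0// mulr0 -opprB uq mulrN.
  have H3 : n%:R^-1 * deficit S (deviation q I Z w) <=
      Num.sqrt (s%:R / n%:R) + Num.sqrt (2 * ln (1 / delta) / n%:R).
    rewrite (_ : s%:R / n%:R = n%:R^-1 ^+ 2 * (s%:R * n%:R)); last by field; rewrite gt_eqF.
    rewrite (_ : 2 * _ / n%:R = n%:R^-1 ^+ 2 * (2 * n%:R * ln (1 / delta))); last first.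
      by field; rewrite gt_eqF.
    rewrite !(sqrtrM _ (sqr_ge0 _)) sqrtr_sqr ger0_norm ?invr_ge0// -mulrDr.
    by rewrite ler_wpM2l ?invr_ge0// leNgt; apply/negP.
  lra.
- have [B [mB PB HB]] := sqrt_deviations nuD num hn indZ lawZ hdelta hs Sth.
  apply: (coverage muX sth (measurable_dH theta) mN N0 mB PB) => w /good[sx su xu] nB.
  have [uS uSc] := HB w nB.
  apply: le_trans (dH_triangle _ (u w) _) _.
  have H1 := dH_le_dTV sx su.
  have H2 := dH_sparse_le su sq sth thS (sqrtr_ge0 _) (sqrtr_ge0 _) uS uSc.
  have H3 := sqrt_sparse_term hn hs Sth hdelta.
  have H4 : Num.sqrt (2 * dTV (mean_of (X ^~ w)) (u w)) + Num.sqrt (2 * dTV q theta) <=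
      Num.sqrt (2 * eps).
    (* Only one of the two sources of error is present in a given model. *)
    have x0 := dTV_ge0 (mean_of (X ^~ w)) (u w).
    case: e_or_q => [e_eq0|q_eq].
      rewrite (_ : dTV (mean_of _) _ = 0) ?mulr0 ?sqrtr0 ?add0r; last by lra.
      by rewrite ler_wsqrtr//; lra.
    rewrite q_eq dTV_self mulr0 sqrtr0 addr0 ler_wsqrtr//; lra.
  rewrite (_ : 1 / n%:R = n%:R^-1); last by rewrite div1r.
  lra.
Qed.
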